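(* The coefficients $b_{2n}$ satisfy the asymptotic formula $$b_{2n}=\left(1+O\left(\frac{\log\log n}{\log n}\right)\right)\frac{\pi^{1/4}}{2^{4n-\frac52}(2n)!}\left(\frac{2n}{\log(2n)}\right)^{7/4}\exp\left[2n\left(\log\left(\frac{2n}{\pi}\right)-W\left(\frac{2n}{\pi}\right)-\frac{1}{W\left(\frac{2n}{\pi}\right)}\right)-\frac1{16}W\left(\frac{2n}{\pi}\right)^2\right]$$ as $n\to\infty$.
   Context: For $x\in\mathbb{R}$ let $$\Phi(x)=2\sum_{m=1}^\infty\left(2\pi^2m^4e^{9x/2}-3\pi m^2e^{5x/2}\right)\exp\left(-\pi m^2e^{2x}\right),$$ and for $n\ge 0$ define $$b_{2n}=\frac{1}{2^{2n}(2n)!}\int_{-\infty}^\infty x^{2n}e^{-x^2/4}\,\Phi(x)\,dx .$$ $W:[0,\infty)\to[0,\infty)$ is the Lambert $W$-function, i.e. the unique increasing function satisfying $W(xe^x)=x$ for all $x\ge0$. *)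

(* Defs.v *)
From HB Require Import structures.
From mathcomp Require Import all_boot all_order all_algebra.
From mathcomp Require Import all_classical all_reals all_analysis.
Set Implicit Arguments.
Unset Strict Implicit.
Unset Printing Implicit Defensive.
Import Order.TTheory GRing.Theory Num.Theory.
Import numFieldNormedType.Exports.
Local Open Scope classical_set_scope.
Local Open Scope ring_scope.

Definition Phi (R : realType) (x : R) : R :=
  2 * \big[+%R/0]_(1 <= m <oo)
        ((2 * pi ^+ 2 * m%:R ^+ 4 * expR (9 * x / 2)
          - 3 * pi * m%:R ^+ 2 * expR (5 * x / 2))
         * expR (- (pi * m%:R ^+ 2 * expR (2 * x)))).

(* [b_even R n] is the coefficient b_{2n}. *)
Definition b_even (R : realType) (n : nat) : R :=
  (2 ^+ (2 * n) * (2 * n)`!%:R)^-1 *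
  \int[lebesgue_measure]_x
    (x ^+ (2 * n) * expR (- (x ^+ 2 / 4)) * Phi x).

(* The values of [W] at negative arguments are unconstrained. *)
Definition is_lambertW (R : realType) (W : R -> R) : Prop :=
  [/\ forall x, 0 <= x -> 0 <= W x,
      forall x y, 0 <= x -> x < y -> W x < W y &
      forall x, 0 <= x -> W (x * expR x) = x].

Definition lambertW (R : realType) : R -> R :=
  xget (fun=> 0) [set W : R -> R | is_lambertW W].

Lemma xexpx_surj (R : realType) (y : R) :
  0 <= y -> exists2 x, 0 <= x & x * expR x = y.
Proof.
move=> y0.
have [||x xy <-] := @IVT R (fun x => x * expR x) 0 y y y0.
- apply: continuous_subspaceT => x.
  by apply: cvgM; [exact: cvg_id|exact: continuous_expR].
- have yle : y <= y * expR y by rewrite ler_peMr// -expR0 ler_expR.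
  by rewrite mul0r ge_min y0/= le_max yle orbT.
- by exists x => //; move: xy; rewrite in_itv/= => /andP[].
Qed.

Lemma xexpx_lt (R : realType) (x y : R) :
  0 <= x -> x < y -> x * expR x < y * expR y.
Proof.
move=> x0 xy; rewrite (@le_lt_trans _ _ (x * expR y))//.
  by rewrite ler_wpM2l// ler_expR ltW.
by rewrite ltr_pM2r// expR_gt0.
Qed.

Lemma xexpx_ltW (R : realType) (x y : R) :
  0 <= y -> x * expR x < y * expR y -> x < y.
Proof.
move=> y0 h; rewrite ltNge le_eqVlt; apply/negP => /orP[/eqP e|yx].
  by move: h; rewrite e ltxx.
by have := lt_trans h (xexpx_lt y0 yx); rewrite ltxx.
Qed.

Lemma is_lambertW_unique (R : realType) (V W : R -> R) :
  is_lambertW V -> is_lambertW W -> forall x, 0 <= x -> V x = W x.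
Proof.
by move=> [_ _ hV] [_ _ hW] x /xexpx_surj[t t0 <-]; rewrite hV// hW.
Qed.

Lemma lambertWP (R : realType) : is_lambertW (@lambertW R).
Proof.
pose w (y : R) := xget 0 [set x | 0 <= x /\ x * expR x = y].
have wP y : 0 <= y -> 0 <= w y /\ w y * expR (w y) = y.
  move=> /xexpx_surj[x x0 xy]; rewrite /w; case: xgetP => [z _ [] //|nex].
  by have := nex x; case.
apply: (@xgetPex _ _ [set W : R -> R | is_lambertW W]); exists w; split.
- by move=> x /wP[].
- move=> x y x0 xy; have [? hx] := wP _ x0.
  have [? hy] := wP _ (le_trans x0 (ltW xy)).
  by apply: xexpx_ltW => //; rewrite hx hy.
- move=> x x0; have [w0 hw] := wP _ (mulr_ge0 x0 (expR_ge0 x)).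
  apply/eqP; rewrite eq_le !leNgt; apply/andP; split; apply/negP => h.
    by have := xexpx_lt x0 h; rewrite hw ltxx.
  by have := xexpx_lt w0 h; rewrite hw ltxx.
Qed.

(* Main.v *)
Require Import Defs.
From HB Require Import structures.
From mathcomp Require Import all_boot all_order all_algebra.
From mathcomp Require Import all_classical all_reals all_analysis.
From mathcomp Require Import measurable_realfun ring lra zify.
Set Implicit Arguments.
Unset Strict Implicit.
Unset Printing Implicit Defensive.
Import Order.TTheory GRing.Theory Num.Theory.
Import numFieldNormedType.Exports.
Local Open Scope classical_set_scope.
Local Open Scope ring_scope.

(** Write [I] for the integral of x^(2n) e^(-x^2/4) Phi(x), so that
b_{2n} = I / (2^(2n) (2n)!).

On x >= 0 the sum defining Phi is governed by its first term,
Phi(x) = 4 pi^2 e^(9x/2 - pi e^(2x)) (1 + O(e^(-2x))), and every term is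
nonnegative ([Phi_lower], [Phi_upper]).  On x < 0 no finite part of the sum
dominates, but Phi is even, so that half contributes as much as the other.
Hence I is, to leading order, 8 pi^2 times the integral over x > 0 of
exp(2n log x - x^2/4 + 9x/2 - pi e^(2x)).  The fast part 2n log x - pi e^(2x) of the exponent is stationary where
2x e^(2x) = 2n/pi, that is at x = w/2 with w = W(2n/pi).  With N = pi e^w one
has 2n = N w, and around w/2 the exponent drops like 2N (x - w/2)^2, up to a
factor 1 + O(1/w).  As N is exponentially large in w, the slow factors
e^(-x^2/4) and e^(9x/2) may be frozen at w/2, and

  I = 8 pi^2 H sqrt(pi / (2N)) (1 + O(1/w)),

where H is the value of that exponential at w/2 ([weighted_Phi_moment]).  Since
log(2n/pi) = log w + w, this product is exactly the claimed main term with
log(2n) replaced by w in the factor (2n / log(2n))^(7/4) ([main_termE]).  That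
replacement costs a relative error O(log w / w), which is
O(log log n / log n) because w and log n are comparable ([relative_error]).
It is the dominant error, so the Gaussian approximation only has to be right
up to O(1/w): pointwise Gaussian bounds on the integrand from both sides are
enough ([saddle_integrand_le], [saddle_integrand_ge]).

The evenness of Phi is Jacobi's functional equation of the theta function
differentiated twice.  If g(x) = e^(x/2) (1 + 2 sum_{m >= 1} e^(-pi m^2 e^(2x)))
then g'' - g/4 = 2 Phi, and g is even by the functional equation
([theta_functional], [PhiN]).  The functional equation is obtained by Polya's
elementary method: summing (2 cos)^(2m) over the l-th roots of unity gives a
finite identity between powers of cosines and binomial coefficients
([cyclic_walk_trace]), whose limit for m ~ s l^2 is the identity between the
two theta series, by dominated convergence of series
([dominated_cvg_series]). *)

(** * Dominated convergence and termwise differentiation of series *)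

Section series_domination.
Context {R : realType}.

Lemma dominated_series_tail (u M : R^nat) (K : nat) :
  (forall k, `|u k| <= M k) -> cvgn (series M) ->
  `|limn (series u) - series u K| <= limn (series M) - series M K.
Proof.
move=> uM cM.
have cu : cvgn (series u).
  apply: normed_cvg; apply: series_le_cvg cM => // n; first exact: normr_ge0.
  exact: le_trans (uM n).
have cuK : (fun n => `|series u n - series u K|) @ \oo -->
    `|limn (series u) - series u K|.
  by apply: cvg_norm; apply: cvgB => //; exact: cvg_cst.
have cMK : (fun n => series M n - series M K) @ \oo -->
    limn (series M) - series M K.
  by apply: cvgB => //; exact: cvg_cst.
rewrite -(cvg_lim _ cuK)// -(cvg_lim _ cMK)//; apply: ler_lim.
- by apply/cvg_ex; eexists; exact: cuK.
- by apply/cvg_ex; eexists; exact: cMK.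
near=> n.
have Kn : (K <= n)%N by near: n; exists K.
rewrite !sub_series_geq//; apply: le_trans (ler_norm_sum _ _ _) _.
exact: ler_sum.
Unshelve. all: by end_near. Qed.

(** Tannery's theorem. *)
Lemma dominated_cvg_series {T : Type} {F : set_system T} {FF : ProperFilter F}
    (f : T -> R^nat) (g M : R^nat) :
  (\forall h \near F, forall k, `|f h k| <= M k) -> cvgn (series M) ->
  (forall k, f h k @[h --> F] --> g k) ->
  limn (series (f h)) @[h --> F] --> limn (series g).
Proof.
move=> fM cM fg.
have gM k : `|g k| <= M k.
  have ck : `|f h k| @[h --> F] --> `|g k| by apply: cvg_norm; exact: fg.
  apply: (closed_cvg (fun y => y <= M k)) ck; first exact: closed_le.
  by apply: filterS fM => h; apply.
apply/cvgrPdist_lt => e e0.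
have e3 : 0 < e / 3 by rewrite divr_gt0.
have [K _ tailK] : \forall K \near \oo, `|limn (series M) - series M K| < e / 3.
  by move: cM => /cvgrPdist_lt/(_ _ e3).
have cK : series (f h) K @[h --> F] --> series g K.
  by apply: cvg_big => [|k _]; [exact: add_continuous|exact: fg].
move/cvgrPdist_lt : cK => /(_ _ e3) cK.
near=> h.
have hK : `|series g K - series (f h) K| < e / 3 by near: h.
have hM : forall k, `|f h k| <= M k by near: h.
have g1 := dominated_series_tail K gM cM.
have f1 := dominated_series_tail K hM cM.
have t1 := le_lt_trans (ler_norm _) (tailK K (leqnn K)).
rewrite (_ : _ - _ = (limn (series g) - series g K)
   + (series g K - series (f h) K) - (limn (series (f h)) - series (f h) K)).
  apply: le_lt_trans (ler_normB _ _) _.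
  apply: (@lt_le_trans _ _ (e / 3 + e / 3 + e / 3)); last by lra.
  apply: ltr_leD; last by apply: le_trans f1 _; exact: ltW.
  apply: le_lt_trans (ler_normD _ _) _.
  by apply: ler_ltD => //; apply: le_trans g1 _; exact: ltW.
by ring.
Unshelve. all: by end_near. Qed.

(** The difference quotients of the terms are bounded by [M] thanks to the mean
value theorem, so dominated convergence applies to them. *)
Lemma is_derive_series (f f' : nat -> R -> R) (M : R^nat) (x r : R) :
  0 < r ->
  (forall k y, `|y - x| < r -> is_derive y 1 (f k) (f' k y)) ->
  (forall k y, `|y - x| < r -> `|f' k y| <= M k) -> cvgn (series M) ->
  (forall y, `|y - x| < r -> cvgn (series (f ^~ y))) ->
  is_derive x 1 (fun y => limn (series (f ^~ y))) (limn (series (f' ^~ x))).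
Proof.
move=> r0 df bf cM cf.
have xr : `|x - x| < r by rewrite subrr normr0.
pose q (h : R) k := h^-1 * (f k (h + x) - f k x).
have qM : \forall h \near (0:R)^', forall k, `|q h k| <= M k.
  near=> h => k.
  have h0 : h != 0 by near: h; exact: nbhs_dnbhs_neq.
  have hr : `|h| < r.
    by near: h; exact: dnbhs0_lt.
  rewrite /q normrM normfV ler_pdivrMl ?normr_gt0//.
  have dk a b : `|a - x| < r -> `|b - x| < r -> a <= b ->
      `|f k b - f k a| <= `|b - a| * M k.
    move=> ax bx ab.
    have abx z : z \in `[a, b] -> `|z - x| < r.
      rewrite in_itv/= => /andP[az zb]; move: ax bx.
      by rewrite !ltr_norml => /andP[? ?] /andP[? ?]; apply/andP; split; lra.
    have dab z : z \in `]a, b[ -> is_derive z 1 (f k) (f' k z).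
      move=> zab; apply: df; apply: abx; move: zab; rewrite !in_itv/=.
      by move=> /andP[/ltW-> /ltW->].
    have [|c cab ->] := MVT_segment ab dab.
      apply: derivable_within_continuous => z /abx /(df k) ?.
      exact: ex_derive.
    by rewrite normrM mulrC ler_wpM2l// bf// abx.
  have hx : `|h + x - x| < r by rewrite addrK.
  have [hh|hh] := leP 0 h.
    by have := dk x (h + x) xr hx; rewrite addrK; apply; rewrite lerDr.
  have := dk (h + x) x hx xr; rewrite distrC [`|x - _|]distrC addrK; apply.
  by rewrite gerDr ltW.
have qc k : q h k @[h --> 0^'] --> f' k x.
  have /(_ k x xr) [/cvg_ex[l fl] e] := df.
  move: e; rewrite /derive/= (cvg_lim _ fl)// => <-.
  apply: cvg_trans fl; apply: near_eq_cvg; near=> h.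
  by rewrite /q/= scaler1.
have key : limn (series (q h)) @[h --> (0:R)^'] --> limn (series (f' ^~ x)).
  exact: dominated_cvg_series qM cM qc.
suff : (h^-1 *: ((limn (series (f ^~ (h *: (1:R) + x))) -
    limn (series (f ^~ x))))) @[h --> 0^'] --> limn (series (f' ^~ x)).
  move=> fl; apply: DeriveDef; first by apply/cvg_ex; eexists; exact: fl.
  by rewrite /derive; exact: (cvg_lim (@norm_hausdorff _ _) fl).
apply: cvg_trans key; apply: near_eq_cvg; near=> h.
have hr : `|h| < r.
  by near: h; exact: dnbhs0_lt.
rewrite scaler1; apply/esym.
have ch : cvgn (series (f ^~ (h + x))) by apply: cf; rewrite addrK.
have cx := cf x xr.
rewrite -lim_seriesB// -lim_seriesZ//; last exact: is_cvg_seriesB.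
Unshelve. all: by end_near. Qed.

End series_domination.

(** * Theta series *)

Section theta.
Context {R : realType}.
Implicit Types (t x : R) (j k : nat).

Definition theta_term j t k : R :=
  k.+1%:R ^+ (2 * j) * expR (- (pi * k.+1%:R ^+ 2 * t)).

(** Up to the factor (- pi)^j, the j-th derivative of the theta series
sum_{m >= 1} e^(- pi m^2 t); the summation index is k = m - 1. *)
Definition theta j t : R := limn (series (theta_term j t)).

Lemma theta_term_ge0 j t k : 0 <= theta_term j t k.
Proof. by rewrite mulr_ge0// ?exprn_ge0// ?ler0n// expR_ge0. Qed.

Lemma exprn_le_expR x j : 0 <= x -> x ^+ j <= j`!%:R * expR x.
Proof.
case: j => [|j] x0; first by rewrite expr0 fact0 mul1r -expR0 ler_expR.
have := expR_ge1Dxn j x0.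
have f0 : 0 < j.+1`!%:R :> R by rewrite ltr0n fact_gt0.
rewrite -ler_pdivrMl// => h; apply: le_trans h.
by rewrite mulrC lerDr.
Qed.

(** One half of the exponent absorbs the power of m, the other half leaves a
geometric series. *)
Lemma is_cvg_theta j t : 0 < t -> cvgn (series (theta_term j t)).
Proof.
move=> t0.
have p0 : 0 < pi :> R := pi_gt0 _.
pose c : R := pi * t / 2.
have c0 : 0 < c by rewrite /c divr_gt0 ?mulr_gt0.
pose C : R := j`!%:R / c ^+ j.
have C0 : 0 <= C by rewrite divr_ge0 ?exprn_ge0 ?ler0n// ltW.
apply: (@series_le_cvg _ _ (geometric C (expR (- c)))).
- by move=> k; exact: theta_term_ge0.
- by move=> k /=; rewrite mulr_ge0 ?exprn_ge0 ?expR_ge0.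
- move=> k; rewrite /theta_term /geometric/=.
  set m : R := k.+1%:R.
  have m1 : 1 <= m by rewrite /m ler1n.
  have cm0 : 0 <= c * m ^+ 2 by rewrite mulr_ge0 ?exprn_ge0// ltW// (lt_le_trans _ m1).
  have -> : pi * m ^+ 2 * t = c * m ^+ 2 + c * m ^+ 2 by rewrite /c; field.
  rewrite opprD expRD mulrA; apply: ler_pM.
  + by rewrite mulr_ge0 ?expR_ge0// exprn_ge0// (le_trans _ m1).
  + exact: expR_ge0.
  + rewrite expRN ler_pdivrMr ?expR_gt0// /C mulrAC ler_pdivlMr ?exprn_gt0//.
    by rewrite exprM -exprMn [_ * c]mulrC; exact: exprn_le_expR.
  + rewrite -expRM_natl ler_expR mulrN lerN2 mulrC ler_wpM2l ?(ltW c0)//.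
    apply: (@le_trans _ _ m); first by rewrite /m ler_nat.
    by rewrite expr2 ler_peMl// (le_trans _ m1).
- by apply: is_cvg_geometric_series; rewrite ger0_norm ?expR_ge0// expR_lt1 oppr_lt0.
Qed.

Lemma theta_term_ler j t x k : x <= t -> theta_term j t k <= theta_term j x k.
Proof.
move=> xt; rewrite ler_wpM2l ?exprn_ge0// ler_expR lerN2 ler_wpM2l//.
by rewrite mulr_ge0 ?pi_ge0 ?exprn_ge0.
Qed.

Lemma theta_ge0 j t : 0 < t -> 0 <= theta j t.
Proof.
move=> t0; apply: limr_ge; first exact: is_cvg_theta.
by apply: nearW => n; apply: sumr_ge0 => k _; exact: theta_term_ge0.
Qed.

Lemma is_derive_theta j t : 0 < t -> is_derive t 1 (theta j) (- pi * theta j.+1 t).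
Proof.
move=> t0; have t2 : 0 < t / 2 by rewrite divr_gt0.
have near_t y : `|y - t| < t / 2 -> t / 2 < y.
  by rewrite ltr_norml => /andP[h _]; lra.
(* On the interval of radius t / 2 around t every term is bounded by its value
   at t / 2. *)
have -> : - pi * theta j.+1 t =
    limn (series (fun k => - pi * theta_term j.+1 t k)).
  rewrite -[LHS]/(- pi *: limn (series (theta_term j.+1 t))).
  by rewrite -lim_seriesZ//; exact: is_cvg_theta.
apply: (@is_derive_series _ (fun k x => theta_term j x k)
  (fun k x => - pi * theta_term j.+1 x k)
  (fun k => pi * theta_term j.+1 (t / 2) k) t (t / 2)) => //.
- move=> k y _; rewrite /theta_term.
  apply: is_derive_eq.
  rewrite /GRing.scale/= mulr1.
  by rewrite (_ : (2 * j.+1 = 2 * j + 2)%N) ?exprD; [ring|lia].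
- move=> k y /near_t ty; rewrite normrM normrN.
  rewrite !ger0_norm ?pi_ge0 ?theta_term_ge0// ler_wpM2l ?pi_ge0//.
  by apply: theta_term_ler; exact: ltW.
- exact: (is_cvg_seriesZ (k := pi) (@is_cvg_theta j.+1 _ t2)).
- by move=> y /near_t ty; apply: is_cvg_theta; exact: lt_trans ty.
Qed.

End theta.

(** * Powers of cosines summed over roots of unity *)

Section cosine_sums.
Context {R : realType}.
Implicit Types (x : R) (n m j l k p : nat).

Lemma exprn_2cos n x :
  (2 * cos x) ^+ n =
  \sum_(k < n.+1) 'C(n, k)%:R * cos ((n%:R - 2 * k%:R) * x).
Proof.
elim: n => [|n IHn].
  by rewrite big_ord_recl big_ord0 expr0 bin0 mulr0 subr0 mul0r cos0 mulr1 addr0.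
pose F k : R := cos ((n.+1%:R - 2 * k%:R) * x).
have FE k : 2 * cos x * cos ((n%:R - 2 * k%:R) * x) = F k + F k.+1.
  rewrite /F.
  rewrite (_ : (n.+1%:R - 2 * k%:R) * x = (n%:R - 2 * k%:R) * x + x); last by ring.
  rewrite (_ : (n.+1%:R - 2 * k.+1%:R) * x = (n%:R - 2 * k%:R) * x - x); last by ring.
  by rewrite cosD cosB; ring.
rewrite exprS {}IHn big_distrr/=.
under eq_bigr do rewrite mulrCA FE mulrDr.
rewrite big_split/= -/(F _) [RHS]big_ord_recl/= bin0 mul1r.
rewrite -!(big_mkord xpredT (fun k => 'C(n, k)%:R * F k)).
rewrite big_nat_recl// bin0 mul1r -addrA; congr (_ + _).
rewrite [RHS](eq_bigr (fun k : 'I_n.+1 => 'C(n, k.+1)%:R * F k.+1 + 'C(n, k)%:R * F k.+1)).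
  rewrite big_split/=; congr (_ + _).
  by rewrite big_ord_recr/= bin_small// mul0r addr0 big_mkord.
by move=> k _; rewrite /bump/= add1n binS natrD mulrDl.
Qed.

Lemma exprn_2cos_even m x :
  (2 * cos x) ^+ (2 * m) = 'C(2 * m, m)%:R +
  2 * \sum_(j < m) 'C(2 * m, m + j.+1)%:R * cos (2 * j.+1%:R * x).
Proof.
rewrite exprn_2cos.
pose a k : R := 'C(2 * m, k)%:R * cos (((2 * m)%:R - 2 * k%:R) * x).
pose b j : R := 'C(2 * m, m + j.+1)%:R * cos (2 * j.+1%:R * x).
(* The terms of indices m - j and m + j are equal. *)
have am : a m = 'C(2 * m, m)%:R.
  by rewrite /a natrM subrr mul0r cos0 mulr1.
have aD j : a (m + j.+1)%N = b j.
  rewrite /a /b -[in RHS]cosN; congr (_ * cos _).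
  by rewrite natrM natrD; ring.
have aB j : (j < m)%N -> a (m - j.+1)%N = b j.
  move=> jm; rewrite /a /b; congr (_%:R * cos _).
    by rewrite -bin_sub; [congr ('C(_, _)); lia|lia].
  by rewrite natrM natrB//; ring.
rewrite -(big_mkord xpredT a) -(big_mkord xpredT b).
rewrite (@big_cat_nat _ _ _ m)//=; last by lia.
rewrite [X in _ + X]big_ltn ?am; last by lia.
rewrite big_nat_rev/= add0n.
rewrite [X in X + _](@eq_big_nat _ _ _ _ _ _ b); last first.
  by move=> i /andP[_ im]; exact: aB.
rewrite -{1}[m.+1]add0n big_addn.
rewrite [X in _ + (_ + X)](@eq_big_nat _ _ _ _ _ _ b); last first.
  by move=> i _; rewrite -aD; congr a; lia.
rewrite (_ : ((2 * m).+1 - m.+1)%N = m); last by lia.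
by ring.
Qed.

Lemma sum_cos_roots_of_unity l j : (0 < l)%N ->
  \sum_(v < l) cos (2 * j%:R * (pi * v%:R / l%:R) : R) = (l * (l %| j)%N)%:R.
Proof.
move=> l0; have lR : l%:R != 0 :> R by rewrite pnatr_eq0 -lt0n.
have [/dvdnP[q ->]|ndiv] := boolP (l %| j)%N; rewrite ?muln1 ?muln0.
  rewrite (eq_bigr (fun=> 1)); first by rewrite sumr_const card_ord.
  move=> v _; rewrite natrM.
  rewrite (_ : _ * _ = 0 + pi *+ 2 *+ (q * v)).
    by rewrite (periodicn (@cosD2pi R)) cos0.
  by rewrite -[pi *+ 2 *+ _]mulr_natr natrM -[pi *+ 2]mulr_natr; field.
pose h : R := pi * j%:R / l%:R.
have sh : sin h != 0.
  rewrite /h {1}(divn_eq j l) natrD natrM.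
  set r := (j %% l)%N; set q := (j %/ l)%N.
  have r0 : (0 < r)%N by rewrite lt0n.
  have rl : (r < l)%N by rewrite ltn_mod.
  have lR0 : 0 < l%:R :> R by rewrite ltr0n.
  rewrite (_ : _ / _ = pi * r%:R / l%:R + pi *+ q); last first.
    by rewrite -[pi *+ q]mulr_natr; field.
  rewrite (alternatingn (@sinDpi R)) mulf_neq0// ?signr_eq0//.
  rewrite gt_eqF// sin_gt0_pi//; apply/andP; split.
    by rewrite divr_gt0 ?mulr_gt0 ?pi_gt0 ?ltr0n.
  by rewrite ltr_pdivrMr// ltr_pM2l ?pi_gt0// ltr_nat.
(* Multiplication by 2 sin h turns the sum into a telescoping one. *)
apply: (mulfI (mulf_neq0 (_ : 2 != 0 :> R) sh)); first by rewrite pnatr_eq0.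
rewrite mulr0 big_distrr/=.
pose g v : R := sin (2 * v%:R * h - h).
rewrite (eq_bigr (fun v : 'I_l => g v.+1 - g v)); last first.
  move=> v _; rewrite /g.
  rewrite (_ : 2 * j%:R * _ = 2 * v%:R * h); last by rewrite /h; field.
  rewrite (_ : 2 * v.+1%:R * h - h = 2 * v%:R * h + h); last by ring.
  by rewrite sinD sinB; ring.
rewrite -(big_mkord xpredT (fun v => g v.+1 - g v)) telescope_sumr//.
rewrite /g mulr0 mul0r sub0r (_ : 2 * l%:R * h = pi *+ 2 *+ j); last first.
  by rewrite /h -[pi *+ 2 *+ _]mulr_natr -[pi *+ 2]mulr_natr; field.
by rewrite [_ - h]addrC (periodicn (@sinD2pi R)) subrr.
Qed.

(** In each block of l consecutive indices only the last one contributes. *)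
Lemma sum_multiples (b : nat -> R) l n : (0 < l)%N ->
  \sum_(j < n * l) (l %| j.+1)%N%:R * b j.+1 = \sum_(k < n) b (k.+1 * l)%N.
Proof.
move=> l0.
elim: n => [|n IHn]; first by rewrite mul0n !big_ord0.
rewrite big_ord_recr/= -{}IHn mulSnr.
rewrite -!(big_mkord xpredT (fun j => (l %| j.+1)%N%:R * b j.+1)).
rewrite (@big_cat_nat _ _ _ (n * l))//=; last by rewrite leq_addr.
congr (_ + _).
have -> : (n * l + l = (n * l + l.-1).+1)%N by rewrite -addnS prednK.
rewrite big_nat_recr/=; last by rewrite leq_addr.
rewrite big1_seq ?add0r.
  by rewrite -addnS prednK// -mulSnr dvdn_mull// mul1r.
move=> i; rewrite mem_index_iota => /andP[_ /andP[h1 h2]].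
rewrite (_ : (l %| i.+1)%N = false) ?mul0r//.
apply/negP => /dvdnP[q e].
have : (n < q)%N by rewrite -(ltn_pmul2r l0) -e.
have : (q < n.+1)%N by rewrite -(ltn_pmul2r l0) -e mulSnr; lia.
by lia.
Qed.

Definition central_ratio m j : R := 'C(2 * m, m + j)%:R / 'C(2 * m, m)%:R.

Lemma central_bin_gt0 m : 0 < 'C(2 * m, m)%:R :> R.
Proof. by rewrite ltr0n bin_gt0; lia. Qed.

Lemma central_ratio_small m j : (m < j)%N -> central_ratio m j = 0.
Proof. by move=> mj; rewrite /central_ratio bin_small ?mul0r//; lia. Qed.

(** Both sides are, up to normalization, the trace of the 2m-th power of the
simple random walk on the cycle of length l: on the left through the
eigenvalues, on the right through the closed paths, counted by winding number.
The length is odd so that the nontrivial eigenvalues come in pairs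
v, l - v. *)
Lemma cyclic_walk_trace m p (l := (2 * p).+1) :
  1 + 2 * \sum_(v < p) cos (pi * v.+1%:R / l%:R) ^+ (2 * m) =
  l%:R * ('C(2 * m, m)%:R / 4 ^+ m) *
  (1 + 2 * \sum_(k < m) central_ratio m (k.+1 * l)).
Proof.
have l0 : (0 < l)%N by [].
have lR : l%:R != 0 :> R by rewrite pnatr_eq0.
have c0 := lt0r_neq0 (central_bin_gt0 m).
pose f v : R := cos (pi * v%:R / l%:R) ^+ (2 * m).
transitivity (\sum_(v < l) f v).
  rewrite -(big_mkord xpredT f) big_nat_recl// {1}/f mulr0 mul0r cos0 expr1n.
  congr (_ + _); rewrite (@big_cat_nat _ _ _ p)//=; last by lia.
  rewrite [X in _ = _ + X]big_nat_rev/=.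
  have shift_p (F : nat -> R) :
      \sum_(p <= i < 2 * p) F i = \sum_(0 <= i < p) F (i + p)%N.
    by rewrite -{1}[p]add0n big_addn (_ : (2 * p - p)%N = p)//; lia.
  rewrite shift_p.
  rewrite [X in _ = _ + X](@eq_big_nat _ _ _ _ _ _ (fun i => f i.+1)).
    by rewrite -(big_mkord xpredT (fun v => f v.+1)); ring.
  move=> i /andP[_ ip].
  have e : (p + 2 * p - (i + p).+1).+1 = (l - i.+1)%N by rewrite /l; lia.
  rewrite e /f natrB; last by rewrite /l; lia.
  rewrite (_ : pi * _ / _ = - (pi * i.+1%:R / l%:R) + pi); last by field.
  by rewrite cosDpi cosN !exprM sqrrN.
have m4 : (4 : R) ^+ m != 0 by rewrite expf_neq0// pnatr_eq0.
have -> : \sum_(v < l) f v =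
    (\sum_(v < l) (2 * cos (pi * v%:R / l%:R)) ^+ (2 * m)) / 4 ^+ m.
  rewrite big_distrl/=; apply: eq_bigr => v _.
  rewrite exprMn (_ : (2 : R) ^+ (2 * m) = 4 ^+ m); last first.
    by rewrite exprM; congr (_ ^+ _); ring.
  by rewrite mulrC mulKf.
under eq_bigr do rewrite exprn_2cos_even.
rewrite big_split/= sumr_const card_ord -big_distrr/= exchange_big/=.
under eq_bigr do rewrite -big_distrr/= sum_cos_roots_of_unity// natrM.
have -> : \sum_(k < m) central_ratio m (k.+1 * l) =
  \sum_(j < m) (l %| j.+1)%N%:R * central_ratio m j.+1.
  rewrite -(sum_multiples (central_ratio m))//.
  rewrite -!(big_mkord xpredT (fun j => (l %| j.+1)%N%:R * central_ratio m j.+1)).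
  rewrite (@big_cat_nat _ _ _ m)//=; last by rewrite leq_pmulr.
  rewrite [X in _ + X]big1_seq ?addr0// => i; rewrite mem_index_iota.
  by move=> /andP[_ /andP[h1 h2]]; rewrite central_ratio_small ?mulr0.
have -> : \sum_(j < m) (l %| j.+1)%N%:R * central_ratio m j.+1 =
    (\sum_(j < m) 'C(2 * m, m + j.+1)%:R * (l%:R * (l %| j.+1)%N%:R)) /
    (l%:R * 'C(2 * m, m)%:R).
  rewrite big_distrl/=; apply: eq_bigr => j _; rewrite /central_ratio.
  by field; rewrite lR c0.
rewrite -[_ *+ l]mulr_natr.
set S := \sum_(j < m) _.
move: (4 ^+ m) m4 => M M0.
move: ('C(2 * m, m)%:R) c0 => C c0.
move: l%:R lR @S => L L0 S. field.
by rewrite L0 M0 c0.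
Qed.

End cosine_sums.

(** * Gaussian limits of cosines and binomial coefficients *)

Section polya_estimates.
Context {R : realType}.
Implicit Types (x y : R) (m j k n : nat).

Lemma central_ratioS m j : (j < m)%N ->
  central_ratio m j.+1 = central_ratio m j * ((m%:R - j%:R) / (m%:R + j%:R + 1)) :> R.
Proof.
move=> jm; have c0 := lt0r_neq0 (@central_bin_gt0 R m).
have := mul_bin_left (2 * m) (m + j).
rewrite (_ : (2 * m - (m + j))%N = (m - j)%N); last by lia.
move=> /(congr1 (fun n : nat => n%:R : R)); rewrite !natrM natrB; last exact: ltnW.
rewrite -natr1 natrD /central_ratio addnS => e.
have d0 : m%:R + j%:R + 1 != 0 :> R by rewrite -!natrD natr1 pnatr_eq0.
apply: (mulfI d0); rewrite mulrA e.
by field; rewrite c0 d0.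
Qed.

Lemma central_ratio0 m : central_ratio m 0 = 1 :> R.
Proof. by rewrite /central_ratio addn0 divff// lt0r_neq0// central_bin_gt0. Qed.

Lemma central_ratio_ge0 m j : 0 <= central_ratio m j :> R.
Proof. by rewrite divr_ge0. Qed.

(** The ratio is the product over i < j of (m - i) / (m + i + 1), and the
numbers 2i + 1 for i < j add up to j^2. *)
Lemma central_ratio_le m j : (j <= m)%N ->
  central_ratio m j <= expR (- (j%:R ^+ 2 / (m%:R + j%:R))) :> R.
Proof.
move=> jm.
suff H i : (i <= j)%N ->
    central_ratio m i <= expR (- (i%:R ^+ 2 / (m%:R + j%:R))) :> R by exact: H.
elim: i => [|i IHi] ij.
  by rewrite central_ratio0 expr0n/= mul0r oppr0 expR0.
have im : (i < m)%N by exact: leq_trans jm.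
have mj0 : 0 < m%:R + j%:R :> R by rewrite -natrD ltr0n; lia.
have mi0 : 0 < m%:R + i%:R + 1 :> R by rewrite -natrD natr1 ltr0n.
rewrite central_ratioS//.
have -> : i.+1%:R ^+ 2 / (m%:R + j%:R) =
    i%:R ^+ 2 / (m%:R + j%:R) + (2 * i%:R + 1) / (m%:R + j%:R) :> R.
  by rewrite -natr1; field; rewrite gt_eqF.
rewrite opprD expRD; apply: ler_pM.
- exact: central_ratio_ge0.
- by rewrite divr_ge0// ?(ltW mi0)// subr_ge0 ler_nat ltnW.
- by apply: IHi; exact: ltnW.
- have -> : (m%:R - i%:R) / (m%:R + i%:R + 1) =
      1 + - ((2 * i%:R + 1) / (m%:R + i%:R + 1)) :> R.
    by field; rewrite gt_eqF.
  apply: le_trans (expR_ge1Dx _) _; rewrite ler_expR lerN2.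
  apply: ler_wpM2l; first by rewrite addr_ge0// mulr_ge0.
  rewrite lef_pV2 ?posrE// -addrA lerD2l natr1 ler_nat//.
Qed.

(** As for the upper bound, now from
(m - i) / (m + i + 1) = 1 / (1 + (2i + 1) / (m - i)). *)
Lemma central_ratio_ge m j : (j <= m)%N ->
  expR (- (j%:R ^+ 2 / (m%:R - j%:R + 1))) <= central_ratio m j :> R.
Proof.
move=> jm.
suff H i : (i <= j)%N ->
    expR (- (i%:R ^+ 2 / (m%:R - j%:R + 1))) <= central_ratio m i :> R by exact: H.
elim: i => [|i IHi] ij.
  by rewrite central_ratio0 expr0n/= mul0r oppr0 expR0.
have im : (i < m)%N by exact: leq_trans jm.
have mj0 : 0 < m%:R - j%:R + 1 :> R by rewrite -natrB// natr1 ltr0n.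
have mi0 : 0 < m%:R - i%:R :> R by rewrite subr_gt0 ltr_nat.
have ijm : m%:R - j%:R + 1 <= m%:R - i%:R :> R.
  rewrite -(natrB _ jm) -(natrB _ (ltnW im)) natr1 ler_nat.
  by clear -ij im jm; lia.
have mi1 : 0 < m%:R + i%:R + 1 :> R by rewrite -natrD natr1 ltr0n.
rewrite central_ratioS//.
have -> : i.+1%:R ^+ 2 / (m%:R - j%:R + 1) =
    i%:R ^+ 2 / (m%:R - j%:R + 1) + (2 * i%:R + 1) / (m%:R - j%:R + 1) :> R.
  by rewrite -natr1; field; rewrite gt_eqF.
rewrite opprD expRD; apply: ler_pM; rewrite ?expR_ge0//.
  by apply: IHi; exact: ltnW.
rewrite expRN -[leRHS]invrK lef_pV2 ?posrE ?expR_gt0 ?invr_gt0 ?divr_gt0//.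
have -> : ((m%:R - i%:R) / (m%:R + i%:R + 1))^-1 =
    1 + (2 * i%:R + 1) / (m%:R - i%:R) :> R.
  by field; rewrite !gt_eqF.
apply: le_trans (expR_ge1Dx _) _; rewrite ler_expR.
apply: ler_wpM2l; first by rewrite addr_ge0// mulr_ge0.
by rewrite lef_pV2 ?posrE.
Qed.

(** The two Gaussian-like bounds on even powers of the cosine come from
cos^2 = 1 - sin^2 and cos^2 = 1 / (1 + tan^2). *)
Lemma cos_exprn_le m x : cos x ^+ (2 * m) <= expR (- (m%:R * sin x ^+ 2)).
Proof.
rewrite exprM -mulrN expRM_natl; apply: lerXn2r; rewrite ?nnegrE ?expR_ge0 ?sqr_ge0//.
by rewrite cos2sin2; exact: expR_ge1Dx.
Qed.

Lemma cos_exprn_ge m x : 0 < cos x ->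
  expR (- (m%:R * tan x ^+ 2)) <= cos x ^+ (2 * m).
Proof.
move=> cx; rewrite exprM -mulrN expRM_natl.
apply: lerXn2r; rewrite ?nnegrE ?expR_ge0 ?sqr_ge0//.
rewrite expRN -[leRHS]invrK lef_pV2 ?posrE ?expR_gt0 ?invr_gt0 ?exprn_gt0//.
by rewrite cos2_tan2 ?gt_eqF//; exact: expR_ge1Dx.
Qed.

(** A linear lower bound valid on the whole quarter period: by the doubling
formula it follows from z cos z <= sin z at z = x / 2, where
cos^2 z >= 1/2. *)
Lemma sin_ge_half x : 0 <= x <= pi / 2 -> x / 2 <= sin x.
Proof.
move=> /andP[x0 xpi]; have pi0 := @pi_gt0 R.
have sc (z : R) : 0 <= z <= pi -> z * cos z <= sin z.
  move=> /andP[z0 zpi].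
  have [|c] := @MVT_segment R sin cos 0 z z0.
  - by apply: continuous_subspaceT; exact: continuous_sin.
  rewrite in_itv/= => /andP[c0 cz]; rewrite sin0 !subr0 => ->.
  rewrite mulrC ler_wpM2r//; move: cz; rewrite le_eqVlt => /orP[/eqP->//|cz].
  by apply: ltW; rewrite ltr_cos// in_itv/= ?z0 ?zpi ?c0 ?(le_trans (ltW cz)).
have -> : x = (x / 2) *+ 2 by rewrite -mulr_natr; field.
rewrite sin_mulr2n; set z := x / 2.
have z0 : 0 <= z by rewrite /z divr_ge0.
have zpi : z <= pi / 2 by rewrite /z; lra.
have cz : 0 <= cos z by apply: cos_ge0_pihalf; apply/andP; split; lra.
have cz2 : 1 / 2 <= cos z ^+ 2.
  have : 0 <= cos (z *+ 2).
    by apply: cos_ge0_pihalf; rewrite /z -mulr_natr; apply/andP; split; lra.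
  by rewrite cos_mulr2n -mulr_natr; lra.
have := sc z; rewrite z0 (le_trans zpi); last by lra.
move=> /(_ isT) /(ler_wpM2l cz) h.
rewrite -[z *+ 2]mulr_natr -[(_ * _) *+ 2]mulr_natr; move: h; rewrite mulrCA -expr2 => h.
have : z * (1 / 2) <= z * cos z ^+ 2 by rewrite ler_wpM2l.
by lra.
Qed.

(** Used for l sin(c / l) --> c along a sequence l --> +oo. *)
Lemma cvg_derive_seq (f : R -> R) (a d : R) (v : R^nat) :
  is_derive a 1 f d -> (forall n, v n != 0) -> v @ \oo --> 0 ->
  (fun n => (v n)^-1 * (f (v n + a) - f a)) @ \oo --> d.
Proof.
move=> [/cvg_ex[l fl] e] v0 vc.
move: e; rewrite /derive/= (cvg_lim _ fl)// => <-.
move/cvgr_dnbhsP : fl => /(_ v (conj v0 vc)); apply: cvg_trans.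
by apply: near_eq_cvg; apply: nearW => n /=; rewrite scaler1.
Qed.

Definition scaled_central_bin n : R := Num.sqrt n%:R * ('C(2 * n, n)%:R / 4 ^+ n).

(** This sequence increases, and it is bounded by 1 because
(2n + 1) (C(2n, n) / 4^n)^2 decreases from 1.  The value of the limit is not
computed: it will be read off from the functional equation at t = 1. *)
Lemma is_cvg_scaled_central_bin : cvgn scaled_central_bin.
Proof.
pose q n : R := 'C(2 * n, n)%:R / 4 ^+ n.
have q0 n : 0 < q n by rewrite divr_gt0 ?central_bin_gt0 ?exprn_gt0.
have qS n : q n.+1 = q n * ((2 * n%:R + 1) / (2 * n%:R + 2)).
  have e1 := mul_bin_diag (2 * n).+2 n.
  have e2 := mul_bin_down (2 * n).+1 n.
  have e4 : ('C(2 * n.+1, n.+1) * n.+1 = 2 * (2 * n + 1) * 'C(2 * n, n))%N.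
    rewrite (_ : (2 * n.+1 = (2 * n).+2)%N); last by lia.
    move: e1 e2 => /=; rewrite (_ : ((2 * n).+1 - n = n.+1)%N); last by lia.
    lia.
  move: e4 => /(congr1 (fun n : nat => n%:R : R)); rewrite !natrM natrD natrM.
  move=> e; have n0 : n.+1%:R != 0 :> R by rewrite pnatr_eq0.
  rewrite /q.
  have {e} -> : 'C(2 * n.+1, n.+1)%:R = 2 * (2 * n%:R + 1) * 'C(2 * n, n)%:R / n.+1%:R :> R.
    by rewrite -e mulfK.
  rewrite exprS -natr1; field.
  have n2 : 2 * n%:R + 2 != 0 :> R by rewrite -natrM -natrD pnatr_eq0 addn2.
  by rewrite n2 addrC natr1 n0 expf_neq0// pnatr_eq0.
have q00 : q 0%N = 1 by rewrite /q bin0 expr0 divr1.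
have scE n : scaled_central_bin n = Num.sqrt n%:R * q n by [].
clearbody q; apply: (@nondecreasing_is_cvgn _ scaled_central_bin).
  apply/nondecreasing_seqP => n; rewrite !scE.
  rewrite -ler_sqr ?nnegrE ?mulr_ge0 ?sqrtr_ge0//; try exact: ltW (q0 _).
  rewrite !exprMn !sqr_sqrtr// qS.
  rewrite [_ ^+ 2 in leRHS]exprMn mulrCA mulrC ler_wpM2l ?sqr_ge0//.
  rewrite expr_div_n mulrA ler_pdivlMr ?exprn_gt0//.
  rewrite -natr1 -subr_ge0.
  by rewrite (_ : _ - _ = n%:R + 1); [rewrite addr_ge0|ring].
exists 1 => _ [n _ <-]; rewrite scE.
have : (2 * n%:R + 1) * q n ^+ 2 <= 1.
  elim: n => [|n IHn].
    by rewrite q00 expr1n mulr0 add0r mulr1.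
  apply: le_trans IHn; rewrite qS exprMn mulrCA [leRHS]mulrC.
  rewrite ler_wpM2l ?sqr_ge0// expr_div_n mulrA ler_pdivrMr ?exprn_gt0//.
  rewrite -natr1 -subr_ge0.
  by rewrite (_ : _ - _ = 2 * n%:R + 1); [rewrite addr_ge0// mulr_ge0|ring].
move=> h; rewrite -ler_sqr ?nnegrE ?mulr_ge0 ?sqrtr_ge0 ?(ltW (q0 n))//.
rewrite expr1n exprMn sqr_sqrtr//.
apply: le_trans h; rewrite ler_wpM2r ?sqr_ge0//.
by have : 0 <= n%:R :> R by []; lra.
Qed.

Lemma lim_series_finite (u : R^nat) n :
  (forall k, (n <= k)%N -> u k = 0) -> limn (series u) = \sum_(k < n) u k.
Proof.
move=> u0; apply: cvg_lim => //; rewrite -(big_mkord xpredT u).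
have -> : \sum_(0 <= k < n) u k = series u n by [].
apply: cvg_near_cst; near=> N.
have nN : (n <= N)%N by near: N; exists n.
apply/eqP; rewrite -subr_eq0 sub_series_geq// big1_seq// => k.
by rewrite mem_index_iota => /andP[_ /andP[/u0]].
Unshelve. all: by end_near. Qed.

End polya_estimates.

(** * Jacobi's functional equation *)

Section jacobi.
Context {R : realType}.
Implicit Types (s t : R) (m j k n p : nat).

Section polya_limit.
Variables (s : R) (s0 : 0 < s).

(* The diffusive scaling: walks of 2 m steps on a cycle of odd length l, with
   m ~ s l^2.  The ratio m / l^2 is u, and v = 1 / l. *)
Let l p : nat := (2 * p).+1.
Let v p : R := (l p)%:R^-1.
Let m p : nat := Num.truncn (s * (l p)%:R ^+ 2).
Let u p : R := (m p)%:R / (l p)%:R ^+ 2.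

Let l_gt0 p : 0 < (l p)%:R :> R. Proof. by rewrite ltr0n. Qed.
Let v_gt0 p : 0 < v p. Proof. by rewrite invr_gt0. Qed.

Let v_cvg0 : v @ \oo --> 0.
Proof.
have h := @cvg_harmonic R.
apply: (squeeze_cvgr _ (cvg_cst 0) h).
near=> p; rewrite ltW//= /v lef_pV2 ?posrE ?ltr0n// ler_nat /l.
by lia.
Unshelve. all: by end_near. Qed.

Let mE p : (m p)%:R = u p * (l p)%:R ^+ 2.
Proof. by rewrite /u divfK// gt_eqF// exprn_gt0. Qed.

Let u_cvg : u @ \oo --> s.
Proof.
have h : (fun p => s - v p) @ \oo --> s.
  rewrite -[X in _ --> X]subr0; apply: cvgB; first exact: cvg_cst.
  exact: v_cvg0.
apply: (squeeze_cvgr _ h (cvg_cst s)); near=> p.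
have l2 : 0 < (l p)%:R ^+ 2 :> R by rewrite exprn_gt0.
have sl : 0 <= s * (l p)%:R ^+ 2 by rewrite mulr_ge0// ltW.
have := truncn_itv sl; rewrite -/(m p) -natr1 => /andP[h1 h2].
rewrite /u ler_pdivlMr// ler_pdivrMr// h1 andbT.
rewrite mulrBl lerBlDr (le_trans (ltW h2))// lerD2l /v expr2 mulKf ?gt_eqF//.
by rewrite ler1n.
Unshelve. all: by end_near. Qed.

Let u_bounds : \forall p \near \oo, s / 2 < u p < 2 * s.
Proof.
near=> p; apply/andP; split.
- near: p; apply: (cvgr_gt _ u_cvg). have := s0; lra.
- near: p; apply: (cvgr_lt _ u_cvg); have := s0; lra.
Unshelve. all: by end_near. Qed.

Let m_cvgy : m @ \oo --> \oo.
Proof.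
apply/cvgnyPge => A; near=> p.
have /andP[up _] : s / 2 < u p < 2 * s by near: p.
have : v p < s / 2 / (A%:R + 1).
  by near: p; apply: (cvgr_lt _ v_cvg0); rewrite !divr_gt0// ltr_wpDl.
rewrite ltr_pdivlMr; last by rewrite ltr_wpDl.
move=> /lt_trans/(_ up); rewrite /u /v ltr_pdivlMr ?exprn_gt0//.
rewrite (_ : _ * _ * _ = (A%:R + 1) * (l p)%:R); last by field; rewrite gt_eqF.
move=> h.
rewrite -(ler_nat R); apply: ltW; apply: le_lt_trans h.
apply: (@le_trans _ _ (A%:R + 1)); first by rewrite lerDl.
by rewrite ler_peMr ?addr_ge0// ler1n.
Unshelve. all: by end_near. Qed.

Let cvg_expRN (w : R^nat) (a : R) : w @ \oo --> a ->
  (fun p => expR (- w p)) @ \oo --> expR (- a).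
Proof.
move=> wa; apply: (cvg_comp _ _ (cvgN wa)); exact: continuous_expR.
Qed.

Let cvg_cos_term k :
  (fun p => cos (pi * k.+1%:R / (l p)%:R) ^+ (2 * m p)) @ \oo -->
  theta_term 0 (pi * s) k.
Proof.
pose K : R := k.+1%:R; pose y p : R := pi * K / (l p)%:R.
have yv : (fun p => y p) @ \oo --> 0.
  rewrite -[X in _ --> X](mulr0 (pi * K)).
  by apply: cvgM; [exact: cvg_cst|exact: v_cvg0].
have cosy : (fun p => cos (y p)) @ \oo --> (1:R).
  rewrite -[X in _ --> X]cos0; apply: (cvg_comp _ _ yv).
  exact: continuous_cos.
have siny : (fun p => (l p)%:R * sin (y p)) @ \oo --> pi * K.
  have D : is_derive (0 : R) 1 (fun x : R => sin (pi * K * x)) (pi * K).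
    apply: is_derive_eq; rewrite mulr0 cos0.
    by rewrite /GRing.scale/= !mulr1 ?mul1r.
  have := cvg_derive_seq D (fun p => lt0r_neq0 (v_gt0 p)) v_cvg0.
  apply: cvg_trans; apply: near_eq_cvg; apply: nearW => p /=.
  by rewrite addr0 mulr0 sin0 subr0 /v invrK.
have msin : (fun p => (m p)%:R * sin (y p) ^+ 2) @ \oo --> s * (pi * K) ^+ 2.
  have -> : (fun p => (m p)%:R * sin (y p) ^+ 2) =
      (fun p => u p * ((l p)%:R * sin (y p)) ^+ 2).
    by apply/funext => p; rewrite mE; ring.
  apply: cvgM; first exact: u_cvg.
  under eq_fun do rewrite expr2.
  by rewrite expr2; apply: cvgM.
have mtan : (fun p => (m p)%:R * tan (y p) ^+ 2) @ \oo --> s * (pi * K) ^+ 2.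
  have -> : (fun p => (m p)%:R * tan (y p) ^+ 2) =
      (fun p => ((m p)%:R * sin (y p) ^+ 2) * ((cos (y p))^-1 * (cos (y p))^-1)).
    by apply/funext => p; rewrite /tan expr_div_n -exprVn expr2; ring.
  rewrite -[X in _ --> X]mulr1 -[X in _ * X]mulr1 -[X in X * X]invr1.
  by apply: cvgM => //; apply: cvgM; apply: cvgV => //; exact: oner_neq0.
have -> : theta_term 0 (pi * s) k = expR (- (s * (pi * K) ^+ 2)).
  by rewrite /theta_term muln0 expr0 mul1r -/K; congr (expR (- _)); ring.
apply: (squeeze_cvgr _ (cvg_expRN mtan) (cvg_expRN msin)).
near=> p; rewrite cos_exprn_le andbT cos_exprn_ge//.
by near: p; apply: (cvgr_gt _ cosy); exact: ltr01.
Unshelve. all: by end_near. Qed.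

Let cvg_ratio_term k :
  (fun p => central_ratio (m p) (k.+1 * l p) : R) @ \oo -->
  theta_term 0 (pi * s)^-1 k.
Proof.
pose K : R := k.+1%:R.
have lim1 : (fun p => K ^+ 2 / (u p + K * v p)) @ \oo --> K ^+ 2 / s.
  rewrite -[X in _ / X]addr0 -(mulr0 K); apply: cvgM; first exact: cvg_cst.
  apply: cvgV; first by rewrite mulr0 addr0 gt_eqF.
  apply: cvgD; first exact: u_cvg.
  by apply: cvgM; [exact: cvg_cst|exact: v_cvg0].
have lim2 : (fun p => K ^+ 2 / (u p - K * v p + v p * v p)) @ \oo --> K ^+ 2 / s.
  have -> : s = s - K * 0 + 0 * 0 by ring.
  apply: cvgM; first exact: cvg_cst.
  apply: cvgV; first by rewrite !mulr0 subr0 addr0 gt_eqF.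
  apply: cvgD; last by apply: cvgM; exact: v_cvg0.
  apply: cvgB; first exact: u_cvg.
  by apply: cvgM; [exact: cvg_cst|exact: v_cvg0].
have -> : theta_term 0 (pi * s)^-1 k = expR (- (K ^+ 2 / s)).
  rewrite /theta_term muln0 expr0 mul1r -/K; congr (expR (- _)).
  have := lt0r_neq0 (@pi_gt0 R); move: (@pi R) => P P0.
  by field; rewrite P0 gt_eqF.
apply: (squeeze_cvgr _ (cvg_expRN lim2) (cvg_expRN lim1)).
near=> p.
have /andP[up _] : s / 2 < u p < 2 * s by near: p.
have Km : (k.+1 * l p <= m p)%N.
  have : K * v p < s / 2.
    near: p; apply: (cvgr_lt (K * 0)); last by rewrite mulr0 divr_gt0.
    by apply: cvgM; [exact: cvg_cst|exact: v_cvg0].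
  move=> /lt_trans/(_ up); rewrite /u /v ltr_pdivrMr// => h.
  rewrite -(ler_nat R) natrM -/K; apply: ltW.
  by move: h; rewrite expr2 invfM mulrA mulfVK ?gt_eqF// ltr_pdivlMr.
have l0 := gt_eqF (l_gt0 p).
apply/andP; split.
- apply: (le_trans _ (central_ratio_ge Km)); rewrite ler_expR lerN2 natrM -/K mE.
  have -> : u p * (l p)%:R ^+ 2 - K * (l p)%:R + 1 =
      (u p - K * v p + v p * v p) * (l p)%:R ^+ 2.
    by rewrite /v; field; rewrite l0.
  by rewrite exprMn invfM mulrACA divff ?mulr1// expf_neq0// l0.
- apply: le_trans (central_ratio_le Km) _; rewrite ler_expR lerN2 natrM -/K mE.
  have -> : u p * (l p)%:R ^+ 2 + K * (l p)%:R =
      (u p + K * v p) * (l p)%:R ^+ 2.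
    by rewrite /v; field; rewrite l0.
  by rewrite exprMn invfM mulrACA divff ?mulr1// expf_neq0// l0.
Unshelve. all: by end_near. Qed.

Let cos_term_le : \forall p \near \oo, forall k,
  `|if (k < p)%N then cos (pi * k.+1%:R / (l p)%:R) ^+ (2 * m p) else 0| <=
  theta_term 0 (s * pi / 8) k.
Proof.
near=> p => k.
have /andP[up _] : s / 2 < u p < 2 * s by near: p.
case: ifPn => [kp|_]; last by rewrite normr0 theta_term_ge0.
rewrite ger0_norm; last by rewrite exprM exprn_ge0// sqr_ge0.
apply: le_trans (cos_exprn_le _ _) _.
rewrite /theta_term muln0 expr0 mul1r ler_expR lerN2.
set K : R := k.+1%:R; set y := pi * K / (l p)%:R.
have pi0 := @pi_gt0 R.
have K0 : 0 < K by rewrite ltr0n.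
have y0 : 0 <= y by rewrite divr_ge0// mulr_ge0// ltW.
have yp : y <= pi / 2.
  rewrite /y ler_pdivrMr// -mulrA ler_pM2l// mulrC ler_pdivlMr// /K -natrM ler_nat.
  by rewrite /l; clear -kp; lia.
have siny : y / 2 <= sin y by apply: sin_ge_half; rewrite y0.
have siny2 : (y / 2) ^+ 2 <= sin y ^+ 2.
  have y2 : 0 <= y / 2 by rewrite divr_ge0.
  by apply: lerXn2r; rewrite ?nnegrE// (le_trans y2).
apply: (le_trans _ (ler_wpM2l (ler0n _ _) siny2)).
have -> : (m p)%:R * (y / 2) ^+ 2 = u p * (pi * K / 2) ^+ 2.
  by rewrite mE /y; field; rewrite gt_eqF.
apply: (le_trans _ (ler_wpM2r (sqr_ge0 _) (ltW up))).
by rewrite le_eqVlt; apply/orP; left; apply/eqP; field.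
Unshelve. all: by end_near. Qed.

Let ratio_term_le : \forall p \near \oo, forall k,
  `|central_ratio (m p) (k.+1 * l p)| <= theta_term 0 (4 * pi * s)^-1 k :> R.
Proof.
near=> p => k.
have /andP[up1 up2] : s / 2 < u p < 2 * s by near: p.
have pi0 := @pi_gt0 R.
rewrite ger0_norm ?central_ratio_ge0//.
have [Km|Km] := leqP (k.+1 * l p) (m p); last first.
  by rewrite central_ratio_small// theta_term_ge0.
apply: le_trans (central_ratio_le Km) _.
rewrite /theta_term muln0 expr0 mul1r ler_expR lerN2.
set K : R := k.+1%:R.
have K0 : 0 < K by rewrite ltr0n.
have -> : pi * K ^+ 2 * (4 * pi * s)^-1 = K ^+ 2 / (4 * s).
  have := lt0r_neq0 pi0; move: (@pi R) => P P0.
  by field; rewrite P0 gt_eqF.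
rewrite ler_pdivlMr; last first.
  by rewrite ltr_pwDr// ltr0n muln_gt0.
have KmR : (k.+1 * l p)%:R <= (m p)%:R :> R by rewrite ler_nat.
apply: (@le_trans _ _ (K ^+ 2 / (4 * s) * (4 * s * (l p)%:R ^+ 2))).
  rewrite ler_wpM2l ?divr_ge0 ?sqr_ge0 ?mulr_ge0 ?(ltW s0)//.
  apply: (@le_trans _ _ (2 * (m p)%:R)); first by lra.
  rewrite mE mulrA ler_wpM2r ?sqr_ge0//; lra.
rewrite natrM -/K le_eqVlt; apply/orP; left; apply/eqP.
by field; rewrite gt_eqF.
Unshelve. all: by end_near. Qed.

(** The limit of [cyclic_walk_trace] in the diffusive scaling. *)
Lemma theta_functional_up_to_constant :
  1 + 2 * theta 0 (pi * s) =
  limn (@scaled_central_bin R) / Num.sqrt s * (1 + 2 * theta 0 (pi * s)^-1).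
Proof.
have pi0 := @pi_gt0 R.
pose f p k : R := if (k < p)%N then cos (pi * k.+1%:R / (l p)%:R) ^+ (2 * m p) else 0.
pose g p k : R := central_ratio (m p) (k.+1 * l p).
have fL : (fun p => 1 + 2 * limn (series (f p))) @ \oo --> 1 + 2 * theta 0 (pi * s).
  apply: cvgD; first exact: cvg_cst.
  apply: cvgM; first exact: cvg_cst.
  apply: (dominated_cvg_series cos_term_le).
    by apply: is_cvg_theta; rewrite divr_gt0// mulr_gt0.
  move=> k /=; have := @cvg_cos_term k; apply: cvg_trans.
  apply: near_eq_cvg; near=> p.
  rewrite /f ifT//; near: p; exists k.+1 => // p /=.
have gL : (fun p => 1 + 2 * limn (series (g p))) @ \oo -->
    1 + 2 * theta 0 (pi * s)^-1.
  apply: cvgD; first exact: cvg_cst.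
  apply: cvgM; first exact: cvg_cst.
  apply: (dominated_cvg_series ratio_term_le).
    by apply: is_cvg_theta; rewrite invr_gt0 !mulr_gt0.
  by move=> k; exact: cvg_ratio_term.
have cL : (fun p => scaled_central_bin (m p) / Num.sqrt (u p)) @ \oo -->
    limn (@scaled_central_bin R) / Num.sqrt s.
  apply: cvgM.
    apply: (cvg_comp _ _ m_cvgy); exact: is_cvg_scaled_central_bin.
  apply: cvgV; first by rewrite sqrtr_eq0 -ltNge.
  by apply: (cvg_comp _ _ u_cvg); exact: sqrt_continuous.
suff : (fun p => 1 + 2 * limn (series (f p))) @ \oo -->
    limn (@scaled_central_bin R) / Num.sqrt s * (1 + 2 * theta 0 (pi * s)^-1).
  exact: (cvg_unique _ fL).
apply: cvg_trans (cvgM cL gL); apply: near_eq_cvg; near=> p; rewrite /=.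
have /andP[up1 _] : s / 2 < u p < 2 * s by near: p.
have up : 0 < u p by apply: lt_trans up1; rewrite divr_gt0.
have -> : limn (series (g p)) = \sum_(k < m p) g p k.
  apply: lim_series_finite => k mk; rewrite /g central_ratio_small//.
  by rewrite mulSn /l; clear -mk; lia.
have -> : limn (series (f p)) = \sum_(k < p) f p k.
  by apply: lim_series_finite => k pk; rewrite /f ltnNge pk.
under [in RHS]eq_bigr => k _ do rewrite /f ltn_ord.
rewrite cyclic_walk_trace -/(l p) /scaled_central_bin; congr (_ * _).
have -> : Num.sqrt (u p) = Num.sqrt (m p)%:R / (l p)%:R.
  by rewrite /u sqrtrM// sqrtrV ?sqr_ge0// sqrtr_sqr ger0_norm.
have sm : Num.sqrt (m p)%:R != 0 :> R.
  by rewrite sqrtr_eq0 -ltNge mE mulr_gt0// exprn_gt0.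
move: ('C(2 * m p, m p)%:R / 4 ^+ m p) (l_gt0 p) => q /lt0r_neq0 l0.
by field; rewrite sm l0.
Unshelve. all: by end_near. Qed.

End polya_limit.

(** At t = 1 the same positive number stands on both sides, which determines the
constant left open in [theta_functional_up_to_constant]. *)
Lemma theta_functional t : 0 < t ->
  Num.sqrt t * (1 + 2 * theta 0 t) = 1 + 2 * theta 0 t^-1.
Proof.
move=> t0; have pi0 := @pi_gt0 R.
set c := limn (@scaled_central_bin R) * Num.sqrt pi.
have H x : 0 < x -> 1 + 2 * theta 0 x = c / Num.sqrt x * (1 + 2 * theta 0 x^-1).
  move=> x0; have xpi : 0 < x / pi by rewrite divr_gt0.
  have e : pi * (x / pi) = x by rewrite mulrCA divff ?mulr1// gt_eqF.
  have := theta_functional_up_to_constant xpi; rewrite e => ->.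
  rewrite /c sqrtrM ?(ltW x0)// sqrtrV ?(ltW pi0)//; congr (_ * _).
  by field; rewrite !gt_eqF// sqrtr_gt0.
have c1 : c = 1.
  have := H 1 ltr01; rewrite invr1 sqrtr1 divr1.
  have : 0 < 1 + 2 * theta 0 1 :> R.
    by rewrite ltr_pwDl// mulr_ge0// theta_ge0.
  by move=> /lt0r_neq0 h; rewrite -{1}[X in X = _]mul1r => /(mulIf h).
rewrite (H t t0) c1 mul1r mulrA divff ?mul1r// gt_eqF// sqrtr_gt0//.
Qed.

End jacobi.

(** * Evenness and size of the kernel Phi *)

Section xi_kernel.
Context {R : realType}.
Implicit Types x y : R.

Definition phi_term x k : R :=
  (2 * pi ^+ 2 * k.+1%:R ^+ 4 * expR (9 * x / 2)
   - 3 * pi * k.+1%:R ^+ 2 * expR (5 * x / 2))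
  * expR (- (pi * k.+1%:R ^+ 2 * expR (2 * x))).

Lemma phi_termE x k : phi_term x k =
  2 * pi ^+ 2 * expR (9 * x / 2) * theta_term 2 (expR (2 * x)) k
  + - (3 * pi * expR (5 * x / 2)) * theta_term 1 (expR (2 * x)) k.
Proof. by rewrite /phi_term /theta_term; ring. Qed.

Lemma phi_series_cvg x : series (phi_term x) @ \oo -->
  2 * pi ^+ 2 * expR (9 * x / 2) * theta 2 (expR (2 * x))
  - 3 * pi * expR (5 * x / 2) * theta 1 (expR (2 * x)).
Proof.
have e0 : 0 < expR (2 * x) by exact: expR_gt0.
have -> : series (phi_term x) = fun n =>
    2 * pi ^+ 2 * expR (9 * x / 2) * series (theta_term 2 (expR (2 * x))) n
    + - (3 * pi * expR (5 * x / 2)) * series (theta_term 1 (expR (2 * x))) n.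
  apply/funext => n; rewrite /series/= !big_distrr/= -big_split/=.
  by apply: eq_bigr => k _; rewrite phi_termE.
rewrite -[X in _ --> _ + X]mulNr.
by apply: cvgD; (apply: cvgM; [exact: cvg_cst|exact: is_cvg_theta]).
Qed.

Lemma Phi_phi_series x : Phi x = 2 * limn (series (phi_term x)).
Proof.
rewrite /Phi; congr (_ * _); apply: cvg_lim => //.
rewrite -cvg_shiftS.
have -> : [sequence \sum_(1 <= m < n.+1)
    ((2 * pi ^+ 2 * m%:R ^+ 4 * expR (9 * x / 2)
      - 3 * pi * m%:R ^+ 2 * expR (5 * x / 2))
     * expR (- (pi * m%:R ^+ 2 * expR (2 * x))))]_n = series (phi_term x).
  by apply/funext => n /=; rewrite big_add1.
by apply/cvg_ex; eexists; exact: phi_series_cvg.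
Qed.

Lemma PhiE x : Phi x =
  2 * (2 * pi ^+ 2 * expR (9 * x / 2) * theta 2 (expR (2 * x))
       - 3 * pi * expR (5 * x / 2) * theta 1 (expR (2 * x))).
Proof. by rewrite Phi_phi_series (cvg_lim _ (@phi_series_cvg x)). Qed.

(** The symmetric form of the theta function; its evenness is the functional
equation at t = e^(2x). *)
Definition theta_even x : R := expR (x / 2) * (1 + 2 * theta 0 (expR (2 * x))).

Definition theta_even' x : R :=
  theta_even x / 2 - 4 * pi * (expR (5 * x / 2) * theta 1 (expR (2 * x))).

Lemma theta_evenN x : theta_even (- x) = theta_even x.
Proof.
have h := theta_functional (expR_gt0 (2 * x)).
have sq : Num.sqrt (expR (2 * x)) = expR x.
  by rewrite mulr_natl mulr2n expRD -expr2 sqrtr_sqr ger0_norm// expR_ge0.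
rewrite /theta_even mulrN expRN; move: h; rewrite {}sq.
move: (expR (2 * x)) (@theta R 0) => z th <-.
by rewrite mulrA -expRD; congr (expR _ * _); field.
Qed.

Lemma is_derive_theta_exp j x :
  is_derive x 1 (fun y => theta j (expR (2 * y)))
    (- pi * theta j.+1 (expR (2 * x)) * (2 * expR (2 * x))).
Proof.
have D1 : is_derive x 1 (fun y : R => expR (2 * y)) (2 * expR (2 * x)).
  by apply: is_derive_eq; rewrite /GRing.scale/=; ring.
have D2 := @is_derive_theta R j _ (expR_gt0 (2 * x)).
exact: (@is_derive1_comp _ (theta j) (fun y => expR (2 * y)) x _ _ D2 D1).
Qed.

Lemma is_derive_theta_even x : is_derive x 1 theta_even (theta_even' x).
Proof.
have D := is_derive_theta_exp 0 x.
apply: is_derive_eq; rewrite /theta_even' /theta_even /GRing.scale/=.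
have -> : 5 * x / 2 = x / 2 + 2 * x by field.
by rewrite expRD; field.
Qed.

(** For h(x) = e^(x/2) e^(-u) with u = pi m^2 e^(2x) one has
h'' - h/4 = (4 u^2 - 6 u) h, and twice this is the m-th term of 2 Phi; the
constant term of the theta function contributes e^(x/2), which the operator
kills. *)
Lemma is_derive_theta_even' x :
  is_derive x 1 theta_even' (2 * Phi x + theta_even x / 4).
Proof.
have D := is_derive_theta_even x; have D1 := is_derive_theta_exp 1 x.
apply: is_derive_eq; rewrite PhiE /theta_even' /GRing.scale/=.
have -> : 9 * x / 2 = 5 * x / 2 + 2 * x by field.
by rewrite expRD; field.
Qed.

(** Phi is a combination of an even function and of its second derivative, which
is even as well. *)
Lemma PhiN x : Phi (- x) = Phi x.
Proof.
have solve (p q b c : R) : - (2 * q + c / 4) = (2 * p + b / 4) * -1 -> b = c -> p = q.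
  by move=> + bc; rewrite bc; lra.
have oppD y : is_derive y 1 (-%R : R -> R) (-1).
  by apply: is_derive_eq.
have even' y : theta_even' (- y) = - theta_even' y.
  have := is_derive1_comp (is_derive_theta_even (- y)) (oppD y).
  have -> : theta_even \o -%R = theta_even.
    by apply/funext => z /=; exact: theta_evenN.
  move=> [_ h1]; have [_ h2] := is_derive_theta_even y.
  by rewrite -h2 h1; ring.
have := is_derive1_comp (is_derive_theta_even' (- x)) (oppD x).
have -> : theta_even' \o -%R = - theta_even'.
  by apply/funext => z /=; exact: even'.
move=> [_ h1].
have D := is_derive_theta_even' x.
have [_ h2] : is_derive x 1 (- theta_even') (- (2 * Phi x + theta_even x / 4)).
  by apply: is_derive_eq.
exact: solve (etrans (esym h2) h1) (theta_evenN x).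
Qed.

Lemma continuous_Phi : continuous (@Phi R).
Proof.
move=> x; apply/differentiable_continuous/derivable1_diffP.
have -> : @Phi R = fun x => 2 * (2 * pi ^+ 2 * expR (9 * x / 2) * theta 2 (expR (2 * x))
       - 3 * pi * expR (5 * x / 2) * theta 1 (expR (2 * x))).
  by apply/funext => y; exact: PhiE.
have D1 := is_derive_theta_exp 1 x; have D2 := is_derive_theta_exp 2 x.
exact: ex_derive.
Qed.

Lemma phi_term_ge0 x k : 0 <= x -> 0 <= phi_term x k.
Proof.
move=> x0; apply: mulr_ge0; last exact: expR_ge0.
have pi2 := @pi_ge2 R; set m : R := k.+1%:R.
have m1 : 1 <= m by rewrite ler1n.
have e1 : 1 <= expR (2 * x) by rewrite -expR0 ler_expR mulr_ge0.
have -> : 9 * x / 2 = 5 * x / 2 + 2 * x by field.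
rewrite expRD (_ : _ - _ = pi * m ^+ 2 * expR (5 * x / 2) *
  (2 * pi * m ^+ 2 * expR (2 * x) - 3)); last by ring.
rewrite mulr_ge0// ?mulr_ge0 ?expR_ge0 ?sqr_ge0 ?pi_ge0// subr_ge0.
apply: (@le_trans _ _ (2 * 2 * 1 * 1)); first by lra.
by rewrite !ler_pM ?mulr_ge0// ?exprn_ege1// ler_wpM2l.
Qed.

(** Relative to the first term, the m-th one is at most
m^4 e^(-m^2) / z: use z <= e^z and pi >= 2 in m^4 e^(-pi (m^2 - 1) z). *)
Lemma theta2_le (z : R) : 1 <= z ->
  theta 2 z <= expR (- (pi * z)) * (1 + theta 2 pi^-1 / z).
Proof.
move=> z1; have z0 : 0 < z by exact: lt_le_trans z1.
have pi0 := @pi_gt0 R; have pi2 := @pi_ge2 R.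
have cp := @is_cvg_theta R 2 pi^-1 (_ : 0 < pi^-1).
have {}cp : cvgn (series (theta_term 2 pi^-1 : R^nat)) by apply: cp; rewrite invr_gt0.
apply: limr_le; first exact: is_cvg_theta.
apply: nearW => -[|n].
  rewrite /series/= big_geq// mulr_ge0 ?expR_ge0// addr_ge0// divr_ge0 ?(ltW z0)//.
  by apply: theta_ge0; rewrite invr_gt0.
rewrite /series/= big_nat_recl//.
have -> : theta_term 2 z 0 = expR (- (pi * z)).
  by rewrite /theta_term !expr1n mul1r mulr1.
rewrite mulrDr mulr1 lerD2l.
apply: (@le_trans _ _ (expR (- (pi * z)) / z *
    \sum_(0 <= k < n.+1) theta_term 2 pi^-1 k)); last first.
  rewrite [leRHS]mulrA [leRHS]mulrAC ler_wpM2l ?divr_ge0 ?expR_ge0 ?(ltW z0)//.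
  apply: (nondecreasing_cvgn_le _ cp n.+1).
  by apply: nondecreasing_series => k _ _; exact: theta_term_ge0.
rewrite [X in _ <= _ * X]big_nat_recl// mulrDr.
apply: (@le_trans _ _ (0 + expR (- (pi * z)) / z *
    \sum_(0 <= k < n) theta_term 2 pi^-1 k.+1)); last first.
  by rewrite lerD2r mulr_ge0 ?theta_term_ge0// divr_ge0 ?expR_ge0// ltW.
rewrite add0r big_distrr/=; apply: ler_sum => k _.
rewrite /theta_term; set m : R := k.+2%:R.
have m2 : 2 <= m by rewrite ler_nat.
rewrite [leRHS]mulrCA ler_wpM2l ?exprn_ge0//.
rewrite [leRHS]mulrAC ler_pdivlMr// -expRD.
have -> : pi * m ^+ 2 / pi = m ^+ 2 by rewrite mulrAC divff ?mul1r// gt_eqF.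
apply: (@le_trans _ _ (expR (- (pi * m ^+ 2 * z)) * expR z)).
  rewrite ler_wpM2l ?expR_ge0//; apply: le_trans (expR_ge1Dx z); lra.
rewrite -expRD ler_expR.
have m4 : 4 <= m ^+ 2 by rewrite (_ : 4 = 2 ^+ 2); [rewrite lerXn2r ?nnegrE//; lra|ring].
suff : m ^+ 2 + z <= pi * (m ^+ 2 - 1) * z by lra.
apply: (@le_trans _ _ (2 * (m ^+ 2 - 1) * z)); last first.
  by rewrite ler_wpM2r ?(ltW z0)// ler_wpM2r//; lra.
nra.
Qed.

(** All terms are nonnegative on x >= 0, so Phi is at least its first
term. *)
Lemma Phi_lower x : 0 <= x ->
  4 * pi ^+ 2 * expR (9 * x / 2 - pi * expR (2 * x)) -
  6 * pi * expR (5 * x / 2 - pi * expR (2 * x)) <= Phi x.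
Proof.
move=> x0; rewrite Phi_phi_series.
have cp : cvgn (series (phi_term x)).
  by apply/cvg_ex; eexists; exact: phi_series_cvg.
have nd : nondecreasing_seq (series (phi_term x)).
  by apply: nondecreasing_series => k _ _; exact: phi_term_ge0.
have := nondecreasing_cvgn_le nd cp 1.
rewrite /series/= big_nat1 => h.
apply: (@le_trans _ _ (2 * phi_term x 0)); last by rewrite ler_wpM2l.
by rewrite !expRD /phi_term expr1n expr1n !mulr1 le_eqVlt; apply/orP; left; apply/eqP; ring.
Qed.

Lemma Phi_ge0 x : 0 <= Phi x.
Proof.
wlog x0 : x / 0 <= x.
  move=> H; have [/H//|x0] := leP 0 x.
  by rewrite -PhiN; apply: H; rewrite oppr_ge0 ltW.
rewrite Phi_phi_series mulr_ge0//; apply: limr_ge.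
  by apply/cvg_ex; eexists; exact: phi_series_cvg.
by apply: nearW => n; apply: sumr_ge0 => k _; exact: phi_term_ge0.
Qed.

Lemma Phi_upper x : 0 <= x ->
  Phi x <= 4 * pi ^+ 2 * (expR (9 * x / 2 - pi * expR (2 * x)) +
    theta 2 pi^-1 * expR (5 * x / 2 - pi * expR (2 * x))).
Proof.
move=> x0; have e1 : 1 <= expR (2 * x) by rewrite -expR0 ler_expR mulr_ge0.
rewrite PhiE; have := theta2_le e1; have := @theta_ge0 R 1 _ (expR_gt0 (2 * x)).
move: (theta 1 (expR (2 * x))) (theta 2 (expR (2 * x))) => t1 t2 t10 t2le.
apply: (@le_trans _ _ (4 * pi ^+ 2 * (expR (9 * x / 2) * t2))).
  have h : 0 <= pi * (expR (5 * x / 2) * t1).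
    exact: mulr_ge0 (pi_ge0 R) (mulr_ge0 (expR_ge0 _) t10).
  move: (@pi R) (expR (9 * x / 2)) (expR (5 * x / 2)) h => P E9 E5 h.
  rewrite (_ : 2 * _ = 4 * P ^+ 2 * (E9 * t2) - 6 * (P * (E5 * t1))); last by ring.
  by rewrite lerBlDr lerDl mulr_ge0.
rewrite ler_wpM2l ?mulr_ge0 ?pi_ge0//.
apply: (le_trans (ler_wpM2l (expR_ge0 _) t2le)).
have -> : 9 * x / 2 = 5 * x / 2 + 2 * x by field.
rewrite !expRD le_eqVlt; apply/orP; left; apply/eqP; field.
by rewrite gt_eqF// expR_gt0.
Qed.

End xi_kernel.

(** * Comparison of the exponential with its quadratic part *)

Section exponential_inequalities.
Context {R : realType}.
Implicit Types s y x : R.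

Lemma twice_sqr_ge0 y : 0 <= 2 * y ^+ 2.
Proof. by rewrite pmulr_rge0// sqr_ge0. Qed.

Lemma derive_ge0_le0 (f df : R -> R) s : (forall x, is_derive x 1 f (df x)) ->
  (forall x, 0 <= x -> 0 <= df x) -> 0 <= s -> f 0 <= f s.
Proof.
move=> fdf df0 s0; rewrite -subr_ge0.
have [|c] := @MVT_segment R f df 0 s s0.
- apply: derivable_within_continuous => x _; have := fdf x => ?; exact: ex_derive.
- rewrite in_itv/= => /andP[c0 _] ->.
  by rewrite mulr_ge0 ?df0 ?subr0.
Qed.

(** In other words tanh s <= s. *)
Lemma expR_double_le s : 0 <= s -> expR (2 * s) * (1 - s) <= 1 + s.
Proof.
move=> s0; rewrite -subr_ge0.
pose f s : R := 1 + s - expR (2 * s) * (1 - s).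
pose df s : R := 1 + expR (2 * s) * (2 * s - 1).
have D x : is_derive x 1 f (df x).
  by apply: is_derive_eq; rewrite /df /GRing.scale/=; ring.
have := @derive_ge0_le0 f df s D _ s0.
rewrite /f mulr0 expR0 mul1r subr0 addr0 subrr; apply => x x0.
have : expR (2 * x) * (1 - 2 * x) <= expR (2 * x) * expR (- (2 * x)).
  by rewrite ler_wpM2l ?expR_ge0//; exact: expR_ge1Dx.
by rewrite expRxMexpNx_1 /df; lra.
Qed.

Lemma expR_double_ge s : 0 <= s -> 1 + 2 * s + 2 * s ^+ 2 <= expR (2 * s).
Proof.
move=> s0; rewrite -subr_ge0.
pose f s : R := expR (2 * s) - (1 + 2 * s + 2 * s ^+ 2).
pose df s : R := 2 * (expR (2 * s) - (1 + 2 * s)).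
have D x : is_derive x 1 f (df x).
  by apply: is_derive_eq; rewrite /df /GRing.scale/=; ring.
have := @derive_ge0_le0 f df s D _ s0.
rewrite /f mulr0 expR0 expr0n/= mulr0 !addr0 subrr; apply => x x0.
by rewrite mulr_ge0// subr_ge0 expR_ge1Dx.
Qed.

(** Together with [expR_remainder_le], this compares e^(2y) - 1 - 2y with its
quadratic part 2 y^2 with a relative error of order y.  On the side where the
exponential is small, the bound is the inverse of [expR_double_le]. *)
Lemma expR_remainder_ge y : 2 * y ^+ 2 / (1 + `|y|) <= expR (2 * y) - 1 - 2 * y.
Proof.
have [y0|y0] := leP 0 y.
  have := expR_double_ge y0; rewrite ger0_norm// => h.
  apply: (@le_trans _ _ (2 * y ^+ 2)); last by lra.
  by rewrite ler_pdivrMr ?ltr_pwDl// ler_peMr ?mulr_ge0 ?sqr_ge0// lerDl.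
have [s s0 ->] : exists2 s, 0 < s & y = - s.
  by exists (- y); rewrite ?oppr_gt0 ?opprK.
rewrite normrN gtr0_norm//.
have s1 : 0 < 1 + s by rewrite addr_gt0.
rewrite ler_pdivrMr// sqrrN mulrN expRN.
have := expR_double_le (ltW s0); rewrite -ler_pdivlMl ?expR_gt0//.
by move: (expR (2 * s))^-1 => e; lra.
Qed.

Lemma expR_remainder_le y : `|y| < 1 ->
  expR (2 * y) - 1 - 2 * y <= 2 * y ^+ 2 / (1 - `|y|).
Proof.
have [y0|y0] := leP 0 y.
  rewrite ger0_norm// => y1; rewrite ler_pdivlMr ?subr_gt0//.
  by have := expR_double_le y0; nra.
have [s s0 ->] : exists2 s, 0 < s & y = - s.
  by exists (- y); rewrite ?oppr_gt0 ?opprK.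
rewrite normrN gtr0_norm//.
move=> s1; have s10 : 0 < 1 - s by rewrite subr_gt0.
rewrite sqrrN mulrN expRN.
apply: (@le_trans _ _ (2 * s ^+ 2)); last first.
  rewrite ler_pdivlMr// ler_piMr ?mulr_ge0 ?sqr_ge0//; lra.
have h := expR_double_ge (ltW s0).
have p0 : 0 < 1 + 2 * s + 2 * s ^+ 2 by rewrite !addr_gt0 ?mulr_gt0 ?exprn_gt0.
have : (expR (2 * s))^-1 <= 1 - 2 * s + 2 * s ^+ 2.
  apply: (@le_trans _ _ (1 + 2 * s + 2 * s ^+ 2)^-1).
    by rewrite lef_pV2 ?posrE ?expR_gt0.
  rewrite -div1r ler_pdivrMr//.
  rewrite [leRHS](_ : _ = 1 + 4 * s ^+ 4); last by ring.
  by rewrite lerDl mulr_ge0// exprn_even_ge0.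
by lra.
Qed.

End exponential_inequalities.

(** * Gaussian bounds on the integrand around the saddle point *)

Section saddle_point.
Context {R : realType}.
Variables (n : nat) (w N a : R).
Hypotheses (NE : N = pi * expR w) (nE : (2 * n)%:R = N * w).
Hypotheses (w6 : 6 <= w) (wN : w ^+ 3 <= N) (a0 : 0 <= a) (a9 : a <= 9 / 2).

(** The first term of Phi contributes two such integrands, with a = 9/2 and
a = 5/2. *)
Definition saddle_integrand x : R :=
  x ^+ (2 * n) * expR (a * x - x ^+ 2 / 4 - pi * expR (2 * x)).

(** The value of [saddle_integrand] at the saddle point w / 2, where
pi e^(2x) = N. *)
Definition saddle_height : R :=
  (w / 2) ^+ (2 * n) * expR (a * w / 2 - w ^+ 2 / 16 - N).

(** The first Gaussian is sharp and serves for |y| <= 1/w; the second one has a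
smaller rate but an exponentially small weight and serves elsewhere. *)
Definition upper_gaussians (y : R) : R :=
  expR (w ^+ 2 * (w + 1) / (8 * N)) * expR (- (2 * N * (w - 1) / (w + 1) * y ^+ 2))
  + expR (- (N / (2 * w ^+ 3))) * expR (- (N / (2 * w) * y ^+ 2)).

Let w0 : 0 < w. Proof. by have := w6; lra. Qed.
Let N0 : 0 < N. Proof. by apply: lt_le_trans wN; rewrite exprn_gt0. Qed.

Lemma saddle_height_gt0 : 0 < saddle_height.
Proof. by rewrite mulr_gt0 ?expR_gt0// exprn_gt0// divr_gt0. Qed.

Let slope : `|a - w / 4| <= w.
Proof.
by rewrite ler_norml; have := (w6, a0, a9) => -[[? ?] ?]; apply/andP; split; lra.
Qed.

Let slope_le y : (a - w / 4) * y <= w * `|y|.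
Proof.
apply: le_trans (ler_norm _) _; rewrite normrM.
by rewrite ler_wpM2r.
Qed.

Let slope_ge y : - (w * `|y|) <= (a - w / 4) * y.
Proof. by have := slope_le (- y); rewrite normrN; lra. Qed.

Let exponentE x (y := x - w / 2) :
  a * x - x ^+ 2 / 4 - pi * expR (2 * x) =
  (a * w / 2 - w ^+ 2 / 16 - N) +
  ((a - w / 4) * y - y ^+ 2 / 4 - N * (expR (2 * y) - 1)).
Proof.
have -> : pi * expR (2 * x) = N * expR (2 * y).
  by rewrite NE -mulrA -expRD; congr (_ * expR _); rewrite /y; field.
by rewrite /y; field.
Qed.

(* With r = x / (w/2) = 1 + 2y/w and 2n = N w, the power r^(2n) is bounded above
   through r <= e^(r - 1), and below through r >= e^(1 - 1/r). *)
Let base_exprn_le x (y := x - w / 2) : 0 <= x ->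
  x ^+ (2 * n) <= (w / 2) ^+ (2 * n) * expR (N * (2 * y)).
Proof.
move=> x0; have -> : x = w / 2 * (1 + 2 * y / w) by rewrite /y; field; rewrite gt_eqF.
rewrite exprMn ler_wpM2l ?exprn_ge0 ?divr_ge0 ?(ltW w0)//.
have -> : N * (2 * y) = (2 * n)%:R * (2 * y / w).
  by rewrite nE; field; rewrite gt_eqF.
rewrite expRM_natl lerXn2r ?nnegrE ?expR_ge0 ?expR_ge1Dx//.
have -> : 1 + 2 * y / w = x * 2 / w by rewrite /y; field; rewrite gt_eqF.
by rewrite divr_ge0 ?mulr_ge0 ?(ltW w0).
Qed.

Let base_exprn_ge x (y := x - w / 2) : `|y| <= w / 4 ->
  (w / 2) ^+ (2 * n) * expR (N * (2 * y - 8 * y ^+ 2 / w)) <= x ^+ (2 * n).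
Proof.
move=> yw; have -> : x = w / 2 * (1 + 2 * y / w) by rewrite /y; field; rewrite gt_eqF.
rewrite [leRHS]exprMn ler_wpM2l ?exprn_ge0 ?divr_ge0 ?(ltW w0)//.
set s := 2 * y / w.
have s2 : - (1 / 2) <= s.
  have /andP[h _] : - (w / 4) <= y <= w / 4 by rewrite -ler_norml.
  by rewrite /s ler_pdivlMr//; lra.
have -> : N * (2 * y - 8 * y ^+ 2 / w) = (2 * n)%:R * (s - 2 * s ^+ 2).
  by rewrite nE /s; field; rewrite gt_eqF.
have s1 : 0 < 1 + s by lra.
rewrite expRM_natl lerXn2r ?nnegrE ?expR_ge0 ?(ltW s1)//.
apply: (@le_trans _ _ (expR (- ((1 + s)^-1 - 1)))).
  rewrite ler_expR.
  rewrite (_ : - (_ - 1) = s - s ^+ 2 / (1 + s)); last by field; rewrite gt_eqF.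
  rewrite lerD2l lerN2 mulrC ler_wpM2r ?sqr_ge0// -div1r ler_pdivrMr//; lra.
rewrite expRN -[leRHS]invrK lef_pV2 ?posrE ?expR_gt0 ?invr_gt0//.
by have := expR_ge1Dx ((1 + s)^-1 - 1); rewrite addrCA subrr addr0.
Qed.

(** The exponent relative to its value at w/2 is at most
- N (e^(2y) - 1 - 2y) + (a - w/4) y.  The linear part is absorbed into a
fraction 1/w of the quadratic one by the inequality of arithmetic and geometric
means for |y| <= 1/w, and for |y| > 1/w by
w |y| <= w^2 y^2 <= (N / w) y^2. *)
Lemma saddle_integrand_le x : 0 <= x ->
  saddle_integrand x <= saddle_height * upper_gaussians (x - w / 2).
Proof.
move=> x0; set y := x - w / 2.
have h := expR_remainder_ge y.
apply: (@le_trans _ _ (saddle_height *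
    expR (- (N * (expR (2 * y) - 1 - 2 * y)) + w * `|y|))).
  rewrite /saddle_integrand exponentE expRD mulrCA /saddle_height.
  rewrite [leRHS]mulrAC [leRHS]mulrC ler_wpM2l ?expR_ge0//.
  apply: le_trans (ler_wpM2r (expR_ge0 _) (base_exprn_le x0)) _.
  rewrite -/y -mulrA -expRD ler_wpM2l ?exprn_ge0 ?divr_ge0 ?(ltW w0)// ler_expR.
  have := slope_le y; have := sqr_ge0 y.
  by set q := y ^+ 2; lra.
rewrite ler_wpM2l ?(ltW saddle_height_gt0)// /upper_gaussians -!expRD.
have y0 : 0 <= `|y| by [].
have yy : y ^+ 2 = `|y| ^+ 2 by rewrite real_normK ?num_real.
have w1 : 0 < w + 1 by rewrite addr_gt0.
have [yw|yw] := leP (`|y|) w^-1.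
  rewrite -[leLHS]addr0; apply: lerD; last exact: expR_ge0.
  rewrite ler_expR.
  have h1 : 2 * y ^+ 2 * w / (w + 1) <= expR (2 * y) - 1 - 2 * y.
    apply: (le_trans _ h); rewrite -mulrA ler_wpM2l ?twice_sqr_ge0//.
    have -> : w / (w + 1) = (1 + w^-1)^-1.
      by field; rewrite !gt_eqF// ?addr_gt0.
    have p1 : 0 < 1 + `|y| by rewrite ltr_pwDl.
    have p2 : 0 < 1 + w^-1 by rewrite addr_gt0// invr_gt0.
    by rewrite lef_pV2 ?posrE// lerD2l.
  have h2 := ler_wpM2l (ltW N0) h1.
  have amgm : w * `|y| <= 2 * N / (w + 1) * y ^+ 2 + w ^+ 2 * (w + 1) / (8 * N).
    rewrite -subr_ge0.
    rewrite (_ : _ - _ = 2 * N / (w + 1) * (`|y| - w * (w + 1) / (4 * N)) ^+ 2).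
      by rewrite mulr_ge0 ?sqr_ge0// divr_ge0 ?mulr_ge0 ?ltW.
    by rewrite yy; field; rewrite !gt_eqF.
  have e : N * (2 * y ^+ 2 * w / (w + 1)) - 2 * N / (w + 1) * y ^+ 2 =
     2 * N * (w - 1) / (w + 1) * y ^+ 2 by field; rewrite gt_eqF.
  by rewrite -e; lra.
rewrite -[leLHS]add0r; apply: lerD; first exact: expR_ge0.
rewrite ler_expR.
have wy : 1 <= w * `|y| by rewrite mulrC -ler_pdivrMr// div1r ltW.
have h1 : 2 * y ^+ 2 / w <= expR (2 * y) - 1 - 2 * y.
  have [y0'|y0'] := leP 0 y.
    have := expR_double_ge y0' => h'.
    apply: (@le_trans _ _ (2 * y ^+ 2)); last by lra.
    rewrite ler_pdivrMr// ler_peMr ?twice_sqr_ge0//; have := w6; lra.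
  apply: (le_trans _ h); rewrite ler_wpM2l ?twice_sqr_ge0//.
  rewrite lef_pV2 ?posrE ?ltr_pwDl// ltr0_norm// /y; have := w6; lra.
have h2 := ler_wpM2l (ltW N0) h1.
have h3 : w * `|y| <= w ^+ 2 * y ^+ 2.
  by rewrite yy -exprMn expr2 ler_peMr// (le_trans _ wy).
have h4 : w ^+ 2 * y ^+ 2 <= N / w * y ^+ 2.
  by rewrite ler_wpM2r ?sqr_ge0// ler_pdivlMr// -exprSr.
have h5 : N / (2 * w ^+ 3) <= N / (2 * w) * y ^+ 2.
  rewrite (_ : N / (2 * w ^+ 3) = N / (2 * w) * (w^-1) ^+ 2); last by field; rewrite gt_eqF.
  rewrite ler_wpM2l ?divr_ge0 ?mulr_ge0 ?(ltW w0) ?(ltW N0)// yy.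
  by rewrite lerXn2r ?nnegrE ?invr_ge0 ?(ltW w0) ?(ltW yw).
have e1 : N * (2 * y ^+ 2 / w) = 4 * (N / (2 * w) * y ^+ 2) by field; rewrite gt_eqF.
have e2 : N / w * y ^+ 2 = 2 * (N / (2 * w) * y ^+ 2) by field; rewrite gt_eqF.
by lra.
Qed.

(** The rate 2N of the true Gaussian, enlarged by the 7/w that pays for the
logarithm, the exponential, the linear term and the slow Gaussian factor. *)
Definition lower_rate : R := 2 * N * (1 + 7 / w).

Lemma lower_rate_gt0 : 0 < lower_rate.
Proof. by rewrite /lower_rate !mulr_gt0// addr_gt0// divr_gt0. Qed.

(** Away from the saddle point, one half of the exponent already yields a small
constant factor and the other half remains a Gaussian. *)
Lemma gaussian_far y : w^-1 <= `|y| ->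
  expR (- (lower_rate * y ^+ 2)) <=
  expR (- (lower_rate / (2 * w ^+ 2))) * expR (- (lower_rate / 2 * y ^+ 2)).
Proof.
move=> yw; rewrite -expRD ler_expR.
have yy : y ^+ 2 = `|y| ^+ 2 by rewrite real_normK ?num_real.
have : lower_rate / 2 * w^-1 ^+ 2 <= lower_rate / 2 * y ^+ 2.
  rewrite ler_wpM2l ?divr_ge0 ?(ltW lower_rate_gt0)// yy.
  by rewrite lerXn2r ?nnegrE ?invr_ge0 ?(ltW w0).
have -> : lower_rate / (2 * w ^+ 2) = lower_rate / 2 * w^-1 ^+ 2.
  by field; rewrite gt_eqF.
by lra.
Qed.

(** The Gaussian lower bound holds for |y| <= 1/w only.  Adding the small
Gaussian of [gaussian_far] makes it hold on the whole half line, so that only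
integrals over the whole line are needed. *)
Lemma saddle_integrand_ge x (y := x - w / 2) : 0 <= x ->
  saddle_height * (expR (- (w ^+ 3 / (4 * N))) * expR (- (lower_rate * y ^+ 2))) <=
  saddle_integrand x + saddle_height *
    (expR (- (lower_rate / (2 * w ^+ 2))) * expR (- (lower_rate / 2 * y ^+ 2))).
Proof.
move=> x0; have := saddle_height_gt0 => H0.
have I0 : 0 <= saddle_integrand x by rewrite mulr_ge0 ?expR_ge0 ?exprn_ge0.
have [yw|yw] := leP (`|y|) w^-1; last first.
  rewrite -[leLHS]add0r lerD// ler_wpM2l ?(ltW H0)//.
  apply: (le_trans _ (gaussian_far (ltW yw))).
  by rewrite ler_piMl ?expR_ge0// expR_le1 oppr_le0 divr_ge0 ?exprn_ge0 ?mulr_ge0 ?ltW.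
apply: (@le_trans _ _ (saddle_integrand x)); last first.
  by rewrite lerDl (mulr_ge0 (ltW H0))// mulr_ge0 ?expR_ge0.
have y0 : 0 <= `|y| by [].
have yy : y ^+ 2 = `|y| ^+ 2 by rewrite real_normK ?num_real.
have iw : w^-1 <= 1 / 6 by rewrite -div1r ler_pdivrMr//; have := w6; lra.
have y1 : `|y| < 1 by lra.
have yw4 : `|y| <= w / 4 by have := w6; lra.
rewrite /saddle_integrand exponentE -/y expRD [leRHS]mulrCA /saddle_height.
rewrite [X in X * _ <= _]mulrC -[leLHS]mulrA ler_wpM2l ?expR_ge0//.
have := ler_wpM2r (expR_ge0 ((a - w / 4) * y - y ^+ 2 / 4 - N * (expR (2 * y) - 1)))
  (base_exprn_ge yw4).
apply: le_trans; rewrite -/y -[leRHS]mulrA ler_wpM2l ?exprn_ge0 ?divr_ge0 ?(ltW w0)//.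
rewrite -!expRD ler_expR.
have h1 : expR (2 * y) - 1 - 2 * y <= 2 * y ^+ 2 * (1 + 2 / w).
  apply: le_trans (expR_remainder_le y1) _; rewrite ler_wpM2l ?twice_sqr_ge0//.
  rewrite -div1r ler_pdivrMr ?subr_gt0//.
  apply: (@le_trans _ _ ((1 + 2 / w) * (1 - w^-1))).
    rewrite (_ : _ * _ = 1 + w^-1 * (1 - 2 * w^-1)); last by field; rewrite gt_eqF.
    by rewrite lerDl mulr_ge0 ?invr_ge0 ?(ltW w0)//; lra.
  by rewrite ler_wpM2l ?addr_ge0 ?divr_ge0 ?(ltW w0)// lerD2l lerN2.
have h2 := ler_wpM2l (ltW N0) h1.
have amgm : w * `|y| <= N / w * y ^+ 2 + w ^+ 3 / (4 * N).
  rewrite -subr_ge0.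
  rewrite (_ : _ - _ = N / w * (`|y| - w ^+ 2 / (2 * N)) ^+ 2).
    by rewrite mulr_ge0 ?sqr_ge0// divr_ge0 ?ltW.
  by rewrite yy; field; rewrite !gt_eqF.
have h3 : y ^+ 2 / 4 <= N / w * y ^+ 2.
  rewrite mulrC ler_wpM2r ?sqr_ge0// ler_pdivlMr//.
  apply: (le_trans _ wN); rewrite exprS.
  have : w * 1 <= w * w ^+ 2 by rewrite ler_wpM2l ?(ltW w0)// exprn_ege1//; have := w6; lra.
  by have := w0; lra.
have h4 := slope_ge y.
have e1 : N * (2 * y - 8 * y ^+ 2 / w) = 2 * N * y - 8 * (N / w * y ^+ 2).
  by field; rewrite gt_eqF.
have e2 : lower_rate * y ^+ 2 = 2 * N * y ^+ 2 + 14 * (N / w * y ^+ 2).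
  by rewrite /lower_rate; field; rewrite gt_eqF.
have e3 : N * (2 * y ^+ 2 * (1 + 2 / w)) = 2 * N * y ^+ 2 + 4 * (N / w * y ^+ 2).
  by field; rewrite gt_eqF.
have e4 : 0 <= N / w * y ^+ 2 by rewrite mulr_ge0 ?sqr_ge0// divr_ge0 ?ltW.
rewrite e1 e2; move: h2; rewrite e3.
move: h3 h4 amgm e4; set q := N / w * _; set p := w ^+ 3 / _; lra.
Qed.

End saddle_point.

(** * Integrals of nonnegative functions bounded by Gaussians *)

Section moments.
Context {R : realType}.
Implicit Types (f g : R -> R) (x v c b m : R).
Local Notation mu := (@lebesgue_measure R).

(** Measurability, sign and value are bundled so that such integrals can be
added and compared without further side conditions. *)
Definition has_integral g v := [/\ measurable_fun [set: R] g,
  forall x, 0 <= g x & (\int[mu]_x (g x)%:E = v%:E)%E].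

Lemma has_integralD g1 g2 v1 v2 : has_integral g1 v1 -> has_integral g2 v2 ->
  has_integral (fun x => g1 x + g2 x) (v1 + v2).
Proof.
move=> [m1 p1 i1] [m2 p2 i2]; split.
- exact: measurable_funD.
- by move=> x; rewrite addr_ge0.
- under eq_integral do rewrite EFinD.
  rewrite ge0_integralD//= ?i1 ?i2//.
  + by move=> x _; rewrite lee_fin.
  + exact/measurable_EFinP.
  + by move=> x _; rewrite lee_fin.
  + exact/measurable_EFinP.
Qed.

Lemma has_integralZ c g v : 0 <= c -> has_integral g v ->
  has_integral (fun x => c * g x) (c * v).
Proof.
move=> c0 [mg pg ig]; split.
- exact: measurable_funM.
- by move=> x; rewrite mulr_ge0.
- under eq_integral do rewrite EFinM.
  rewrite ge0_integralZl_EFin//= ?ig//.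
  + by move=> x _; rewrite lee_fin.
  + exact/measurable_EFinP.
Qed.

Lemma has_integral_le g h v1 v2 : has_integral g v1 -> has_integral h v2 ->
  (forall x, g x <= h x) -> v1 <= v2.
Proof.
move=> [mg pg ig] [mh ph ih] gh; rewrite -lee_fin -ig -ih.
apply: ge0_le_integral => //=.
- by move=> x _; rewrite lee_fin.
- exact/measurable_EFinP.
- exact/measurable_EFinP.
- by move=> x _; rewrite lee_fin.
Qed.

Lemma has_integral_dominated f h v : measurable_fun [set: R] f ->
  (forall x, 0 <= f x) -> has_integral h v -> (forall x, f x <= h x) ->
  has_integral f (\int[mu]_x f x).
Proof.
move=> mf f0 [mh ph ih] fh; split => //.
rewrite /Rintegral fineK// ge0_fin_numE; last first.
  by apply: integral_ge0 => x _; rewrite lee_fin.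
apply: (@le_lt_trans _ _ (v%:E)); last exact: ltry.
rewrite -ih; apply: ge0_le_integral => //=.
- by move=> x _; rewrite lee_fin.
- exact/measurable_EFinP.
- exact/measurable_EFinP.
- by move=> x _; rewrite lee_fin.
Qed.

Lemma has_integral_gaussian b m : 0 < b ->
  has_integral (fun x => expR (- (b * (x - m) ^+ 2))) (Num.sqrt (pi / b)).
Proof.
move=> b0; pose s : R := Num.sqrt (2 * b)^-1.
have s2 : s ^+ 2 *+ 2 = b^-1.
  rewrite sqr_sqrtr ?invr_ge0 ?mulr_ge0 ?(ltW b0)// -mulr_natr.
  by field; rewrite gt_eqF.
have s0 : s != 0 by rewrite gt_eqF// sqrtr_gt0 invr_gt0 mulr_gt0.
have fE : (fun x => expR (- (b * (x - m) ^+ 2))) = normal_fun m s.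
  by apply/funext => x; rewrite /normal_fun s2 invrK mulNr mulrC.
have pk : normal_peak s = (Num.sqrt (pi / b))^-1.
  by rewrite /normal_peak -mulrnAl s2 mulrC.
have sq0 : 0 < Num.sqrt (pi / b) by rewrite sqrtr_gt0 divr_gt0// pi_gt0.
have mf : measurable_fun [set: R] (fun x => expR (- (b * (x - m) ^+ 2))).
  by rewrite fE; exact: measurable_normal_fun.
split => //.
have := integral_normal_pdf m s; rewrite normal_pdfE// pk -fE.
under eq_integral do rewrite EFinM.
rewrite ge0_integralZl_EFin//=.
- move=> h; rewrite -[LHS]mul1e -(divff (lt0r_neq0 sq0)) EFinM -muleA h mule1//.
- exact/measurable_EFinP.
Qed.

End moments.

(** * The moments of Phi *)

Section moment_asymptotics.
Context {R : realType}.
Implicit Types (x m b c : R).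
Local Notation mu := (@lebesgue_measure R).

(** Bounds on the half line become bounds on the line after adding the mirror
image of the bounding function. *)
Lemma even_le_symmetrized (f U : R -> R) : (forall x, f (- x) = f x) ->
  (forall x, 0 <= U x) -> (forall x, 0 <= x -> f x <= U x) ->
  forall x, f x <= U x + U (- x).
Proof.
move=> fN U0 fU x; have [x0|x0] := leP 0 x.
  by apply: (le_trans (fU x x0)); rewrite lerDl.
rewrite -fN; apply: (@le_trans _ _ (U (- x))); last by rewrite lerDr.
by apply: fU; rewrite oppr_ge0 ltW.
Qed.

Lemma symmetrized_le_even (f P U : R -> R) : (forall x, f (- x) = f x) ->
  (forall x, 0 <= x -> P x <= f x + U x) ->
  (forall x, 0 <= x -> P (- x) <= U (- x)) ->
  forall x, P x + P (- x) <= f x + (U x + U (- x)).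
Proof.
move=> fN PfU PU x; have [x0|x0] := leP 0 x.
  by rewrite addrA lerD ?PfU ?PU.
have x1 : 0 <= - x by rewrite oppr_ge0 ltW.
have := PfU _ x1; have := PU _ x1; rewrite opprK fN.
move: (f x) (P x) (P (- x)) (U x) (U (- x)); clear; move=> a b c d e; lra.
Qed.

Lemma has_integral_gaussianN b m : 0 < b ->
  has_integral (fun x => expR (- (b * (- x - m) ^+ 2))) (Num.sqrt (pi / b)).
Proof.
move=> b0; have := has_integral_gaussian (- m) b0.
rewrite (_ : (fun x => _) = (fun x => expR (- (b * (- x - m) ^+ 2))))//.
by apply/funext => x; rewrite opprK -opprD sqrrN.
Qed.

Definition weighted_Phi n x : R := x ^+ (2 * n) * expR (- (x ^+ 2 / 4)) * Phi x.

Lemma weighted_PhiN n x : weighted_Phi n (- x) = weighted_Phi n x.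
Proof.
have xN : (- x) ^+ (2 * n) = x ^+ (2 * n) by rewrite !exprM sqrrN.
by rewrite /weighted_Phi (PhiN x) sqrrN xN.
Qed.

Lemma weighted_Phi_ge0 n x : 0 <= weighted_Phi n x.
Proof.
apply: mulr_ge0; last exact: Phi_ge0.
by rewrite mulr_ge0 ?expR_ge0// exprM exprn_ge0// sqr_ge0.
Qed.

Lemma measurable_weighted_Phi n : measurable_fun [set: R] (weighted_Phi n).
Proof.
apply: measurable_funM; last exact: continuous_measurable_fun (@continuous_Phi R).
apply: measurable_funM; first exact: measurable_funX.
apply: measurableT_comp => //; apply: measurable_funN.
by apply: measurable_funM => //; exact: measurable_funX.
Qed.

(** The error budget: v stands for 1/w, T for half of the predicted integral, and
the a's for the masses of the bounding functions on either side of the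
origin. *)
Lemma sandwich_arith (I T v c a1 a2 a3 a4 : R) :
  0 <= T -> 0 < v -> v <= 1 / 6 -> 0 <= c ->
  I <= a1 + a1 -> a3 + a3 <= I + (a2 + a4 + (a2 + a4)) ->
  a1 <= T * ((1 + c * v) * (1 + 8 * v)) -> a2 <= T * (v * (1 + 8 * v)) ->
  T * (1 - 8 * v) <= a3 -> a4 <= T * (2 * v) ->
  `|I - 2 * T| <= 2 * T * ((13 + 3 * c) * v).
Proof.
move=> T0 v0 v6 c0 up lo k1 k2 k3 k4.
have vv : v * v <= 1 / 6 * v by rewrite ler_wpM2r// ltW.
have cvv : c * (v * v) <= c * (1 / 6 * v) by rewrite ler_wpM2l.
have b1 : (1 + c * v) * (1 + 8 * v) <= 1 + (8 + 3 * c) * v.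
  by have := mulr_ge0 c0 (ltW v0); lra.
have b2 : v * (1 + 8 * v) <= 3 * v by lra.
have d1 := ler_wpM2l T0 b1; have d2 := ler_wpM2l T0 b2.
have Tv : 0 <= T * v by rewrite mulr_ge0// ltW.
have Tcv : 0 <= T * (c * v) by rewrite mulr_ge0// mulr_ge0// ltW.
by rewrite ler_norml; apply/andP; split; lra.
Qed.

Section bounds.
Variables (n : nat) (w N : R).
Hypotheses (NE : N = pi * expR w) (nE : (2 * n)%:R = N * w).
Hypotheses (w6 : 6 <= w) (wN : w ^+ 5 <= N).

Local Notation C := (theta 2 (@pi R)^-1).
Local Notation H9 := (saddle_height n w N (9 / 2)).
Local Notation H5 := (saddle_height n w N (5 / 2)).

Let w0 : 0 < w. Proof. by have := w6; lra. Qed.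
Let N0 : 0 < N. Proof. by apply: (lt_le_trans _ wN); rewrite exprn_gt0. Qed.
Let w1 : 1 <= w. Proof. by have := w6; lra. Qed.
Let wN3 : w ^+ 3 <= N. Proof. by apply: le_trans wN; rewrite ler_weXn2l. Qed.
Let C0 : 0 <= C. Proof. by apply: theta_ge0; rewrite invr_gt0 pi_gt0. Qed.
Let pi0 : 0 < (pi : R). Proof. exact: pi_gt0. Qed.
Let H9_gt0 : 0 < H9. Proof. exact: saddle_height_gt0. Qed.

Let invw6 : w^-1 <= 1 / 6.
Proof. by rewrite -div1r ler_pdivrMr//; have := w6; lra. Qed.

Let invw0 : 0 < w^-1. Proof. by rewrite invr_gt0. Qed.

Let expRN_le : expR (- w) <= w^-1.
Proof.
rewrite expRN lef_pV2 ?posrE ?expR_gt0//.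
by apply: le_trans (expR_ge1Dx w); rewrite lerDr.
Qed.

Let H5E : H5 = H9 * expR (- w).
Proof.
rewrite /saddle_height -[RHS]mulrA -expRD; congr (_ * expR _).
by field.
Qed.

(** The integral of [upper_gaussians]. *)
Definition upper_mass : R :=
  expR (w ^+ 2 * (w + 1) / (8 * N)) * Num.sqrt (pi / (2 * N * (w - 1) / (w + 1)))
  + expR (- (N / (2 * w ^+ 3))) * Num.sqrt (pi / (N / (2 * w))).

Lemma upper_mass_le : upper_mass <= Num.sqrt (pi / (2 * N)) * (1 + 8 / w).
Proof.
rewrite /upper_mass; have wm1 : 0 < w - 1 by have := w6; lra.
have wp1 : 0 < w + 1 by have := w6; lra.
set M := Num.sqrt (pi / (2 * N)).
have M0 : 0 <= M by exact: sqrtr_ge0.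
have -> : pi / (2 * N * (w - 1) / (w + 1)) = pi / (2 * N) * ((w + 1) / (w - 1)).
  move: (@pi R) => P; field.
  by rewrite (gt_eqF N0) (gt_eqF wp1) (gt_eqF wm1).
have -> : pi / (N / (2 * w)) = pi / (2 * N) * (2 * w) ^+ 2 / w.
  by move: (@pi R) => P; field; rewrite !gt_eqF.
have D0 : 0 <= pi / (2 * N) by rewrite divr_ge0 ?mulr_ge0 ?ltW.
have s1 : Num.sqrt (pi / (2 * N) * ((w + 1) / (w - 1))) <= M * (1 + 3 / w).
  rewrite sqrtrM// -/M ler_wpM2l//.
  have q1 : 1 + 2 / (w - 1) = (w + 1) / (w - 1) by field; rewrite gt_eqF.
  apply: (@le_trans _ _ ((w + 1) / (w - 1))).
    have q0 : 1 <= (w + 1) / (w - 1) by rewrite -q1 lerDl divr_ge0// ltW.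
    have q2 := le_trans ler01 q0.
    rewrite -[leRHS]ger0_norm// -sqrtr_sqr ler_wsqrtr//.
    by rewrite expr2 ler_peMr.
  rewrite -q1 lerD2l ler_pdivrMr// mulrAC ler_pdivlMr//.
  by have := w6; lra.
have s2 : Num.sqrt (pi / (2 * N) * (2 * w) ^+ 2 / w) <= M * (2 * w).
  rewrite -mulrA sqrtrM// -/M ler_wpM2l//.
  rewrite -[leRHS]ger0_norm ?mulr_ge0 ?(ltW w0)// -sqrtr_sqr ler_wsqrtr//.
  by rewrite ler_pdivrMr// ler_peMr ?sqr_ge0.
have e1 : expR (w ^+ 2 * (w + 1) / (8 * N)) <= 1 + w^-1 / 2.
  have h : w ^+ 2 * (w + 1) / (8 * N) <= w^-1 / 4.
    rewrite ler_pdivrMr ?mulr_gt0//.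
    apply: (@le_trans _ _ (w^-1 / 4 * (8 * w ^+ 5))); last first.
      by rewrite ler_wpM2l ?divr_ge0 ?(ltW invw0)// ler_wpM2l.
    rewrite (_ : w^-1 / 4 * _ = w ^+ 2 * (2 * w ^+ 2)); last by field; rewrite gt_eqF.
    rewrite ler_wpM2l ?sqr_ge0//.
    have : w * 1 <= w * w by rewrite ler_wpM2l// ltW.
    by rewrite expr2; have := w1; nra.
  apply: (@le_trans _ _ (1 - w^-1 / 4)^-1).
    have p1 : 0 < 1 - w^-1 / 4 by have := invw6; lra.
    rewrite -[leLHS]invrK lef_pV2 ?posrE ?invr_gt0 ?expR_gt0// -expRN.
    by apply: (le_trans _ (expR_ge1Dx _)); rewrite lerD2l lerN2.
  rewrite -div1r ler_pdivrMr; last by have := invw6; lra.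
  by have := invw6; have := invw0; nra.
have e2 : expR (- (N / (2 * w ^+ 3))) * (2 * w) <= 4 * w^-1.
  have kp : 0 < N / (2 * w ^+ 3) by rewrite divr_gt0// mulr_gt0// exprn_gt0.
  rewrite expRN mulrC ler_pdivrMr ?expR_gt0//.
  apply: (@le_trans _ _ (4 * w^-1 * (N / (2 * w ^+ 3)))); last first.
    rewrite ler_wpM2l ?mulr_ge0 ?(ltW invw0)//.
    by apply: le_trans (expR_ge1Dx _); rewrite lerDr.
  rewrite (_ : _ * (N / _) = 2 * (N / w ^+ 4)); last by field; rewrite gt_eqF.
  rewrite ler_wpM2l// ler_pdivlMr ?exprn_gt0//.
apply: (@le_trans _ _ ((1 + w^-1 / 2) * (M * (1 + 3 / w)) + M * (4 * w^-1))).
  apply: lerD; first by rewrite ler_pM ?expR_ge0 ?sqrtr_ge0.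
  apply: (@le_trans _ _ (expR (- (N / (2 * w ^+ 3))) * (M * (2 * w)))).
    by rewrite ler_wpM2l ?expR_ge0.
  by rewrite mulrCA ler_wpM2l.
rewrite mulrCA -mulrDr ler_wpM2l//.
have := invw6; have := invw0; move: (w^-1) => v; nra.
Qed.

Lemma lower_mass_ge : Num.sqrt (pi / (2 * N)) * (1 - 8 / w) <=
  expR (- (w ^+ 3 / (4 * N))) * Num.sqrt (pi / lower_rate w N).
Proof.
set M := Num.sqrt (pi / (2 * N)).
have M0 : 0 <= M by exact: sqrtr_ge0.
have D0 : 0 <= pi / (2 * N) by rewrite divr_ge0 ?mulr_ge0 ?ltW.
have w7 : 0 < 1 + 7 / w by rewrite addr_gt0// divr_gt0.
have -> : pi / lower_rate w N = pi / (2 * N) * (1 + 7 / w)^-1.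
  by rewrite /lower_rate invfM mulrA.
rewrite sqrtrM// -/M mulrCA ler_wpM2l//.
have s1 : (1 + 7 / w)^-1 <= Num.sqrt (1 + 7 / w)^-1.
  have q1 : (1 + 7 / w)^-1 <= 1 by rewrite invf_le1// lerDl divr_ge0 ?ltW.
  have q0 : 0 <= (1 + 7 / w)^-1 by rewrite invr_ge0 ltW.
  rewrite -[leLHS]ger0_norm// -sqrtr_sqr ler_wsqrtr//.
  by rewrite expr2 ler_piMr.
have e1 : 1 - w^-1 <= expR (- (w ^+ 3 / (4 * N))).
  apply: (le_trans _ (expR_ge1Dx _)); rewrite lerD2l lerN2.
  rewrite ler_pdivrMr ?mulr_gt0//.
  apply: (@le_trans _ _ (w^-1 * (4 * w ^+ 5))).
    rewrite (_ : _ * (4 * _) = w ^+ 3 * (4 * w)); last by field; rewrite gt_eqF.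
    by rewrite ler_peMr ?exprn_ge0 ?(ltW w0)//; have := w1; lra.
  by rewrite ler_wpM2l ?(ltW invw0)// ler_wpM2l.
have s2 : 1 - 7 / w <= (1 + 7 / w)^-1.
  rewrite -[leRHS]div1r ler_pdivlMr//.
  by rewrite -subr_sqr expr1n lerBlDr lerDl sqr_ge0.
have a0 : 0 <= 1 - w^-1 by have := invw6; lra.
apply: (@le_trans _ _ ((1 - w^-1) * (1 + 7 / w)^-1)); last first.
  by rewrite ler_pM// invr_ge0 ltW.
apply: (le_trans _ (ler_wpM2l a0 s2)).
by have := invw0; move: (w^-1) => v; nra.
Qed.

Lemma far_mass_le : expR (- (lower_rate w N / (2 * w ^+ 2))) *
  Num.sqrt (pi / (lower_rate w N / 2)) <= Num.sqrt (pi / (2 * N)) * (2 / w).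
Proof.
set M := Num.sqrt (pi / (2 * N)).
have M0 : 0 <= M by exact: sqrtr_ge0.
have D0 : 0 <= pi / (2 * N) by rewrite divr_ge0 ?mulr_ge0 ?ltW.
have w7 : 0 < 1 + 7 / w by rewrite addr_gt0// divr_gt0.
have s1 : Num.sqrt (pi / (lower_rate w N / 2)) <= M * 2.
  have two : 2 = Num.sqrt (2 ^+ 2) :> R by rewrite sqrtr_sqr ger0_norm.
  rewrite [X in _ <= _ * X]two -sqrtrM// ler_wsqrtr//.
  rewrite /lower_rate (_ : _ / (_ / 2) = pi / (2 * N) * (2 / (1 + 7 / w))); last first.
    by move: (@pi R) w7 => P w7'; field; rewrite !gt_eqF// addr_gt0.
  rewrite ler_wpM2l// ler_pdivrMr//.
  have : 0 <= 7 / w by rewrite divr_ge0// ltW.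
  by move: (7 / w) => v; lra.
have e1 : expR (- (lower_rate w N / (2 * w ^+ 2))) <= w^-1.
  apply: le_trans expRN_le; rewrite ler_expR lerN2 ler_pdivlMr ?mulr_gt0 ?exprn_gt0//.
  rewrite /lower_rate; apply: (@le_trans _ _ (2 * N * 1)).
    rewrite mulr1 mulrCA -exprS ler_wpM2l//.
  by rewrite ler_wpM2l ?mulr_ge0 ?(ltW N0)// lerDl divr_ge0 ?ltW.
apply: (@le_trans _ _ (w^-1 * (M * 2))).
  by rewrite ler_pM ?expR_ge0 ?sqrtr_ge0.
by rewrite mulrCA mulrC [2 / w]mulrC [leLHS]mulrC mulrC.
Qed.

Let upper_int m (s : bool) :
  has_integral (fun x => upper_gaussians w N ((if s then - x else x) - m)) upper_mass.
Proof.
have b1 : 0 < 2 * N * (w - 1) / (w + 1).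
  by rewrite divr_gt0 ?mulr_gt0//; have := w6; lra.
have b2 : 0 < N / (2 * w) by rewrite divr_gt0 ?mulr_gt0.
by apply: has_integralD; (apply: has_integralZ; [exact: expR_ge0|]);
  case: s; [exact: has_integral_gaussianN|exact: has_integral_gaussian|
    exact: has_integral_gaussianN|exact: has_integral_gaussian].
Qed.

Let K1 : R := 4 * pi ^+ 2 * (H9 + C * H5).
Let K2 : R := 6 * pi * H5.
Let K3 : R := 4 * pi ^+ 2 * H9.

Let H5_gt0 : 0 < H5. Proof. exact: saddle_height_gt0. Qed.

Let K1_ge0 : 0 <= K1.
Proof.
apply: mulr_ge0; first by rewrite mulr_ge0 ?exprn_ge0 ?(ltW pi0).
by apply: addr_ge0; [exact: ltW|apply: mulr_ge0; [exact: C0|exact: ltW]].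
Qed.

Let K2_ge0 : 0 <= K2.
Proof. by apply: mulr_ge0; [rewrite mulr_ge0 ?(ltW pi0)|exact: ltW]. Qed.

Let K3_ge0 : 0 <= K3.
Proof. by apply: mulr_ge0; [rewrite mulr_ge0 ?exprn_ge0 ?(ltW pi0)|exact: ltW]. Qed.

Let splitE a x : x ^+ (2 * n) * expR (- (x ^+ 2 / 4)) *
  expR (a * x - pi * expR (2 * x)) = saddle_integrand n a x.
Proof.
by rewrite /saddle_integrand -mulrA -expRD; congr (_ * expR _); ring.
Qed.

Let base_ge0 x : 0 <= x ^+ (2 * n) * expR (- (x ^+ 2 / 4)).
Proof. by rewrite mulr_ge0 ?expR_ge0// exprM exprn_ge0// sqr_ge0. Qed.

Let F_le a x : 0 <= a -> a <= 9 / 2 -> 0 <= x -> saddle_integrand n a x <=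
  saddle_height n w N a * upper_gaussians w N (x - w / 2).
Proof. by move=> a0 a9 x0; exact: saddle_integrand_le. Qed.

Let weighted_le x : 0 <= x ->
  weighted_Phi n x <= K1 * upper_gaussians w N (x - w / 2).
Proof.
move=> x0; rewrite /weighted_Phi.
apply: (le_trans (ler_wpM2l (base_ge0 x) (Phi_upper x0))).
rewrite mulrCA mulrDr [_ * (C * _)]mulrCA [9 * x / 2]mulrAC [5 * x / 2]mulrAC !splitE.
rewrite /K1 -[leRHS]mulrA ler_wpM2l ?mulr_ge0 ?exprn_ge0 ?(ltW pi0)//.
rewrite [leRHS]mulrDl lerD//; first by apply: F_le => //; lra.
by rewrite -mulrA ler_wpM2l//; apply: F_le => //; lra.
Qed.

Let far_gaussian y := expR (- (lower_rate w N / (2 * w ^+ 2))) *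
  expR (- (lower_rate w N / 2 * y ^+ 2)).

Let near_gaussian y := expR (- (w ^+ 3 / (4 * N))) * expR (- (lower_rate w N * y ^+ 2)).

Let weighted_ge x : 0 <= x ->
  K3 * near_gaussian (x - w / 2) <= weighted_Phi n x +
    (K2 * upper_gaussians w N (x - w / 2) + K3 * far_gaussian (x - w / 2)).
Proof.
move=> x0.
have a9 : (9 / 2 : R) <= 9 / 2 by [].
have a0 : (0 : R) <= 9 / 2 by lra.
have h1 := saddle_integrand_ge NE nE w6 wN3 a0 a9 x0.
have h2 : saddle_integrand n (5 / 2) x <= H5 * upper_gaussians w N (x - w / 2).
  by apply: F_le => //; lra.
have := ler_wpM2l (base_ge0 x) (Phi_lower x0).
rewrite mulrBr [_ * (4 * pi ^+ 2 * _)]mulrCA [_ * (6 * pi * _)]mulrCA.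
rewrite [9 * x / 2]mulrAC [5 * x / 2]mulrAC !splitE -/(weighted_Phi n x) => h3.
have p4 : 0 <= 4 * pi ^+ 2 :> R by rewrite mulr_ge0 ?exprn_ge0 ?(ltW pi0).
have p6 : 0 <= 6 * pi :> R by rewrite mulr_ge0 ?(ltW pi0).
rewrite -/(near_gaussian (x - w / 2)) -/(far_gaussian (x - w / 2)) in h1.
have {}h1 := ler_wpM2l p4 h1; have {}h2 := ler_wpM2l p6 h2.
rewrite /K3 /K2; move: h1 h2 h3.
move: (near_gaussian _) (far_gaussian _) (upper_gaussians _ _ _) => g1 g2 g3.
move: (saddle_integrand _ _ _) (saddle_integrand _ (5 / 2) _) H9 H5 => F9 F5 h9 h5.
move: (4 * pi ^+ 2) (6 * pi) (weighted_Phi n x) => p4' p6' f.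
by move=> h1 h2 h3; lra.
Qed.

Let far_le x : 0 <= x ->
  K3 * near_gaussian (- x - w / 2) <=
    K2 * upper_gaussians w N (- x - w / 2) + K3 * far_gaussian (- x - w / 2).
Proof.
move=> x0; rewrite -[leLHS]add0r lerD//.
  by rewrite mulr_ge0// /upper_gaussians addr_ge0// mulr_ge0 ?expR_ge0.
rewrite ler_wpM2l// /near_gaussian /far_gaussian.
apply: (le_trans _ (gaussian_far w6 wN3 _)).
  by rewrite ler_piMl ?expR_ge0// expR_le1 oppr_le0 divr_ge0 ?exprn_ge0 ?mulr_ge0 ?ltW.
rewrite -opprD normrN ger0_norm ?addr_ge0 ?divr_ge0 ?(ltW w0)//.
by have := invw6; have := w6; lra.
Qed.

Let lower_rate0 : 0 < lower_rate w N. Proof. exact: lower_rate_gt0. Qed.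

(** The factor 8 pi^2 is twice 4 pi^2, one copy for each half line.  The
correction terms of [Phi_lower] and [Phi_upper] only cost O(1/w), since
the saddle height for a = 5/2 is e^(-w) times the one for a = 9/2. *)
Lemma weighted_Phi_moment :
  `|\int[mu]_x weighted_Phi n x - 8 * pi ^+ 2 * H9 * Num.sqrt (pi / (2 * N))| <=
  8 * pi ^+ 2 * H9 * Num.sqrt (pi / (2 * N)) * ((13 + 3 * C) / w).
Proof.
set I := \int[mu]_x weighted_Phi n x; set M := Num.sqrt (pi / (2 * N)).
have M0 : 0 <= M by exact: sqrtr_ge0.
pose U x := K1 * upper_gaussians w N (x - w / 2).
have U0 x : 0 <= U x.
  by rewrite mulr_ge0// /upper_gaussians addr_ge0// mulr_ge0 ?expR_ge0.
have UI : has_integral (fun x => U x + U (- x)) (K1 * upper_mass + K1 * upper_mass).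
  apply: has_integralD; apply: has_integralZ => //.
  - exact: (upper_int (w / 2) false).
  - exact: (upper_int (w / 2) true).
have fU := even_le_symmetrized (weighted_PhiN n) U0 weighted_le.
have fI : has_integral (weighted_Phi n) I.
  apply: has_integral_dominated UI fU; first exact: measurable_weighted_Phi.
  exact: weighted_Phi_ge0.
have up := has_integral_le fI UI fU.
pose V x := K2 * upper_gaussians w N (x - w / 2) + K3 * far_gaussian (x - w / 2).
pose P x := K3 * near_gaussian (x - w / 2).
pose nm := expR (- (w ^+ 3 / (4 * N))) * Num.sqrt (pi / lower_rate w N).
pose fm := expR (- (lower_rate w N / (2 * w ^+ 2))) * Num.sqrt (pi / (lower_rate w N / 2)).
have PI : has_integral (fun x => P x + P (- x)) (K3 * nm + K3 * nm).
  apply: has_integralD; apply: has_integralZ => //; apply: has_integralZ;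
    rewrite ?expR_ge0//.
  - exact: has_integral_gaussian.
  - exact: has_integral_gaussianN.
have l2 : 0 < lower_rate w N / 2 by rewrite divr_gt0.
have VI : has_integral (fun x => weighted_Phi n x + (V x + V (- x)))
    (I + ((K2 * upper_mass + K3 * fm) + (K2 * upper_mass + K3 * fm))).
  apply: has_integralD => //; apply: has_integralD; apply: has_integralD;
    apply: has_integralZ => //.
  - exact: (upper_int (w / 2) false).
  - by apply: has_integralZ; [exact: expR_ge0|exact: has_integral_gaussian].
  - exact: (upper_int (w / 2) true).
  - by apply: has_integralZ; [exact: expR_ge0|exact: has_integral_gaussianN].
have lo := has_integral_le PI VI (symmetrized_le_even (weighted_PhiN n) weighted_ge far_le).
have umle := upper_mass_le; have nmge := lower_mass_ge; have fmle := far_mass_le.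
rewrite -/M -/nm -/fm in umle nmge fmle.
have H5le : H5 <= H9 * w^-1 by rewrite H5E ler_wpM2l ?(ltW H9_gt0).
pose T := 4 * pi ^+ 2 * H9 * M.
have T0 : 0 <= T by apply: mulr_ge0.
have -> : 8 * pi ^+ 2 * H9 * M = 2 * T by rewrite /T; move: (@pi R) => p; ring.
have k1 : K1 * upper_mass <= T * ((1 + C / w) * (1 + 8 / w)).
  apply: (@le_trans _ _ (4 * pi ^+ 2 * (H9 * (1 + C / w)) * (M * (1 + 8 / w)))).
    apply: ler_pM => //.
      by rewrite /upper_mass addr_ge0// mulr_ge0 ?expR_ge0 ?sqrtr_ge0.
    rewrite /K1 ler_wpM2l ?mulr_ge0 ?exprn_ge0 ?(ltW pi0)// mulrDr mulr1 lerD2l.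
    by rewrite [leRHS]mulrCA ler_wpM2l.
  by rewrite /T le_eqVlt; apply/orP; left; apply/eqP; move: (@pi R) => p; ring.
have k2 : K2 * upper_mass <= T * (w^-1 * (1 + 8 / w)).
  apply: (@le_trans _ _ (6 * pi * (H9 * w^-1) * (M * (1 + 8 / w)))).
    apply: ler_pM => //.
      by rewrite /upper_mass addr_ge0// mulr_ge0 ?expR_ge0 ?sqrtr_ge0.
    by rewrite /K2 ler_wpM2l ?mulr_ge0 ?(ltW pi0).
  have -> : T * (w^-1 * (1 + 8 / w)) = 4 * pi ^+ 2 * (H9 * w^-1) * (M * (1 + 8 / w)).
    by rewrite /T; move: (@pi R) => p; ring.
  apply: ler_wpM2r; first by rewrite mulr_ge0// addr_ge0// divr_ge0// ltW.
  apply: ler_wpM2r; first by rewrite mulr_ge0 ?(ltW H9_gt0) ?(ltW invw0).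
  by rewrite expr2 mulrA ler_wpM2r ?(ltW pi0)//; have := @pi_ge2 R; lra.
have k3 : T * (1 - 8 / w) <= K3 * nm.
  by rewrite /T /K3 -mulrA ler_wpM2l.
have k4 : K3 * fm <= T * (2 / w).
  by rewrite /T /K3 -[leRHS]mulrA ler_wpM2l.
have v0 := invw0; have v6 := invw6; have c0 := C0.
exact: (sandwich_arith T0 v0 v6 c0 up lo).
Qed.

End bounds.
End moment_asymptotics.

(** * Comparison with the main term *)

Section main_term.
Context {R : realType}.
Implicit Types (x w N a c : R).

Definition main_term (n : nat) : R :=
  (pi `^ (1 / 4) / (2 `^ (4 * n%:R - 5 / 2) * (2 * n)`!%:R))
  * ((2 * n%:R) / ln (2 * n%:R)) `^ (7 / 4)
  * expR (2 * n%:R * (ln (2 * n%:R / pi) - lambertW (2 * n%:R / pi)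
                      - (lambertW (2 * n%:R / pi))^-1)
          - 1 / 16 * lambertW (2 * n%:R / pi) ^+ 2).

Let powRE a c : 0 < a -> a `^ c = expR (c * ln a).
Proof. by move=> a0; rewrite /powR gt_eqF. Qed.

(** With all factors written as exponentials, this is a linear identity between
log pi, log 2, log w, w and N w = 2n. *)
Lemma saddle_valueE n w N : N = pi * expR w -> (2 * n)%:R = N * w -> 0 < w ->
  8 * pi ^+ 2 * saddle_height n w N (9 / 2) * Num.sqrt (pi / (2 * N)) =
  2 ^+ (2 * n) * (pi `^ (1 / 4) / 2 `^ (4 * n%:R - 5 / 2)) * N `^ (7 / 4) *
  expR (2 * n%:R * (ln (2 * n%:R / pi) - w - w^-1) - 1 / 16 * w ^+ 2).
Proof.
move=> NE nE w0; have pi0 := @pi_gt0 R.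
have N0 : 0 < N by rewrite NE mulr_gt0 ?expR_gt0.
have expln (x : R) : 0 < x -> x = expR (ln x) by move=> x0; rewrite lnK.
have lN : ln N = ln pi + w by rewrite NE lnM ?posrE ?expR_gt0// expRK.
have t2 : 2 * n%:R = N * w by rewrite -nE natrM.
have lx : ln (2 * n%:R / pi) = ln w + w.
  rewrite t2 ln_div ?posrE ?mulr_gt0// lnM ?posrE// lN; lra.
have lw2 : ln (w / 2) = ln w - ln 2 by rewrite ln_div ?posrE.
have e8 : 8 = expR (3 * ln 2) :> R.
  rewrite expRM_natl lnK ?posrE//; ring.
have epi : pi ^+ 2 = expR (2 * ln pi) :> R by rewrite expRM_natl lnK ?posrE.
have ew : (w / 2) ^+ (2 * n) = expR (2 * n%:R * (ln w - ln 2)).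
  by rewrite -natrM expRM_natl -lw2 lnK ?posrE ?divr_gt0.
have e2n : (2 : R) ^+ (2 * n) = expR (2 * n%:R * ln 2).
  by rewrite -natrM expRM_natl lnK ?posrE.
have es : Num.sqrt (pi / (2 * N)) = expR (2^-1 * (ln pi - (ln 2 + ln N))).
  rewrite -powR12_sqrt ?divr_ge0 ?mulr_ge0 ?ltW// powRE ?divr_gt0 ?mulr_gt0//.
  by rewrite ln_div ?posrE ?mulr_gt0// lnM ?posrE.
rewrite /saddle_height e8 epi ew e2n es !powRE// lx lN -expRN -!expRD.
have tE : n%:R = N * w / 2 by rewrite -t2; field.
rewrite tE; congr expR; move: (ln pi) (ln 2) (ln w) => P l2 lw.
by field; rewrite gt_eqF.
Qed.

Lemma main_termE n w N : N = pi * expR w -> (2 * n)%:R = N * w -> 0 < w ->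
  lambertW (2 * n%:R / pi) = w -> 0 < ln (2 * n%:R : R) ->
  main_term n = (2 ^+ (2 * n) * (2 * n)`!%:R)^-1 *
    (8 * pi ^+ 2 * saddle_height n w N (9 / 2) * Num.sqrt (pi / (2 * N))) *
    (w / ln (2 * n%:R)) `^ (7 / 4).
Proof.
move=> NE nE w0 wE L0; have pi0 := @pi_gt0 R.
have N0 : 0 < N by rewrite NE mulr_gt0 ?expR_gt0.
have t2 : 2 * n%:R = N * w by rewrite -nE natrM.
rewrite (saddle_valueE NE nE w0) /main_term wE.
have -> : (2 * n%:R / ln (2 * n%:R)) `^ (7 / 4) =
    N `^ (7 / 4) * (w / ln (2 * n%:R)) `^ (7 / 4).
  by rewrite -powRM ?divr_ge0 ?(ltW N0) ?(ltW w0) ?(ltW L0)// mulrA -t2.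
have f0 : (2 * n)`!%:R != 0 :> R by rewrite pnatr_eq0 -lt0n fact_gt0.
have p2 : (2 : R) ^+ (2 * n) != 0 by rewrite expf_neq0.
have q2 : 2 `^ (4 * n%:R - 5 / 2) != 0 :> R by rewrite gt_eqF// powR_gt0.
move: (2 `^ (4 * n%:R - 5 / 2)) q2 => q q0.
move: (2 ^+ (2 * n)) p2 => d d0; move: ((2 * n)`!%:R) f0 => f f0.
by field; rewrite q0 f0 d0.
Qed.

Lemma main_term_gt0 n : (0 < n)%N -> 0 < ln (2 * n%:R : R) -> 0 < main_term n.
Proof.
move=> n0 L0; rewrite /main_term; apply: mulr_gt0; last exact: expR_gt0.
apply: mulr_gt0.
  by rewrite divr_gt0 ?powR_gt0 ?pi_gt0// mulr_gt0 ?powR_gt0// ltr0n fact_gt0.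
by rewrite powR_gt0// divr_gt0// mulr_gt0// ltr0n.
Qed.

Lemma b_evenE n : b_even R n = (2 ^+ (2 * n) * (2 * n)`!%:R)^-1 *
  \int[@lebesgue_measure R]_x weighted_Phi n x.
Proof. by []. Qed.

Lemma lambertW_mul_exp x : 0 <= x -> lambertW x * expR (lambertW x) = x.
Proof.
move=> /xexpx_surj[y y0 <-]; have [_ _ WK] := lambertWP R.
by rewrite WK.
Qed.

Lemma lambertW_near_infty a : 0 <= a ->
  \forall n \near \oo, a < lambertW (2 * n%:R / pi : R).
Proof.
move=> a0; have [W0 Wlt WK] := lambertWP R; have pi0 := @pi_gt0 R.
near=> n; rewrite -(WK a a0); apply: Wlt; first by rewrite mulr_ge0 ?expR_ge0.
rewrite ltr_pdivlMr// -ltr_pdivrMl//.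
by near: n; exact: nbhs_infty_gtr.
Unshelve. all: by end_near. Qed.

Lemma powRV x c : 0 < x -> (x `^ c)^-1 = x^-1 `^ c.
Proof. by move=> x0; rewrite -[x^-1]powR_inv1 ?ltW// -powRrM mulN1r powRN. Qed.

(** The upper bound comes from the square of 1 + s. *)
Lemma powR74_bounds (s : R) : 0 <= s -> s <= 1 ->
  1 <= (1 + s) `^ (7 / 4) <= 1 + 3 * s.
Proof.
move=> s0 s1; have p1 : 1 <= 1 + s by rewrite lerDl.
apply/andP; split.
  by rewrite -[leLHS](powRr0 (1 + s)); apply: ler_powR => //; rewrite divr_ge0.
apply: (@le_trans _ _ ((1 + s) `^ 2%:R)).
  by apply: ler_powR => //; rewrite ler_pdivrMr//; lra.
rewrite powR_mulrn ?addr_ge0//.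
have : s * s <= s * 1 by rewrite ler_wpM2l.
by rewrite expr2; lra.
Qed.

(** Taking logarithms in w e^w = 2n/pi gives
log(2n) = w + log w + log pi. *)
Lemma ln_log_ratio n w : (0 < n)%N -> lambertW (2 * n%:R / pi) = w -> 720 <= w ->
  [/\ ln (2 * n%:R) / w = 1 + (ln w + ln pi) / w, (ln w + ln pi) / w <= 1,
      1 <= ln w, 0 <= ln (pi : R) <= 4 & w <= ln n%:R <= 2 * w].
Proof.
move=> n0 wE w720; have pi0 := @pi_gt0 R; have pi2 := @pi_ge2 R.
have pi4 : pi <= 4 :> R by have := @pihalf_lt2 R; rewrite ltr_pdivrMr//; lra.
have w0 : 0 < w by lra.
have nR : 0 < n%:R :> R by rewrite ltr0n.
have x0 : 0 <= 2 * n%:R / pi :> R by rewrite divr_ge0 ?mulr_ge0 ?ltW.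
have wx := lambertW_mul_exp x0; rewrite wE in wx.
have n2E : 2 * n%:R = pi * (w * expR w) by rewrite wx [RHS]mulrC divfK// gt_eqF.
have L : ln (2 * n%:R) = ln pi + (ln w + w).
  by rewrite n2E lnM ?posrE ?mulr_gt0 ?expR_gt0// lnM ?posrE ?expR_gt0// expRK.
have lpi0 : 0 <= ln (pi : R) by apply: ln_ge0; lra.
have lpi4 : ln (pi : R) <= 4.
  by apply: le_trans pi4; apply: ltW; exact: ln_sublinear.
have lw4 : ln w <= w / 4 + 4.
  have -> : w = w / 4 * 4 by field.
  rewrite lnM ?posrE ?divr_gt0//; apply: lerD.
    rewrite (_ : w / 4 * 4 / 4 = w / 4); last by field.
    by apply: ltW; apply: ln_sublinear; rewrite divr_gt0.
  by apply: ltW; exact: ln_sublinear.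
have s1 : (ln w + ln pi) / w <= 1 by rewrite ler_pdivrMr//; lra.
have lw1 : 1 <= ln w.
  rewrite -ler_expR lnK ?posrE//.
  have := @expR_double_le R (1 / 2) ltac:(lra).
  by rewrite (_ : 2 * (1 / 2) = 1); [lra|field].
have wn : w <= ln n%:R.
  rewrite -(expRK w) ler_ln ?posrE ?expR_gt0//.
  rewrite -(ler_pM2l (ltr0Sn R 1)) n2E mulrA.
  have : 2 * expR w <= pi * w * expR w.
    rewrite ler_wpM2r ?expR_ge0//.
    by apply: (@le_trans _ _ (2 * 1)); [rewrite mulr1|apply: ler_pM => //; lra].
  exact.
split => //.
- by rewrite L; field; rewrite gt_eqF.
- by rewrite lpi0.
- rewrite wn/=; apply: (@le_trans _ _ (ln (2 * n%:R))).
    by rewrite ler_ln ?posrE ?mulr_gt0// ler_peMl// ?ltW//; lra.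
  by rewrite L; move: s1; rewrite ler_pdivrMr//; lra.
Qed.

(** With I the integral of [weighted_Phi] and T its approximation in
[weighted_Phi_moment], the quotient is the product of I / T = 1 + O(1/w) and of
(log(2n) / w)^(7/4) = 1 + O(log w / w).  The threshold 720 = 6! is the one
beyond which w^6 <= 6! e^w implies w^5 <= e^w. *)
Lemma relative_error n w : (0 < n)%N -> lambertW (2 * n%:R / pi) = w -> 720 <= w ->
  `|b_even R n / main_term n - 1| <=
  2 * (4 * (13 + 3 * theta 2 pi^-1) + 15) * (ln (ln n%:R) / ln n%:R).
Proof.
move=> n0 wE w720; have pi0 := @pi_gt0 R.
have w0 : 0 < w by lra.
have [Lw s1 lw1 /andP[lpi0 lpi4] /andP[wn n2w]] := ln_log_ratio n0 wE w720.
have nR : 0 < n%:R :> R by rewrite ltr0n.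
have x0 : 0 <= 2 * n%:R / pi :> R by rewrite divr_ge0 ?mulr_ge0 ?ltW.
have wx := lambertW_mul_exp x0; rewrite wE in wx.
pose N : R := pi * expR w.
have N0 : 0 < N by rewrite mulr_gt0 ?expR_gt0.
have nE : (2 * n)%:R = N * w.
  by rewrite natrM /N -mulrA [expR w * w]mulrC wx [RHS]mulrC divfK// gt_eqF.
have w5N : w ^+ 5 <= N.
  apply: (@le_trans _ _ (expR w)).
    have := exprn_le_expR 6 (ltW w0); rewrite (_ : 6`! = 720)%N// => h.
    rewrite -(ler_pM2l w0) -exprS; apply: (le_trans h).
    by rewrite ler_wpM2r ?expR_ge0.
  by rewrite ler_peMl ?expR_ge0//; have := @pi_ge2 R; lra.
have L0 : 0 < ln (2 * n%:R : R).
  apply: (lt_le_trans (lt_le_trans w0 wn)).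
  by rewrite ler_ln ?posrE ?mulr_gt0// ler_peMl// ?ltW//; lra.
have w6 : 6 <= w by lra.
have C0 : 0 <= theta 2 pi^-1 :> R by apply: theta_ge0; rewrite invr_gt0.
have key := weighted_Phi_moment (erefl N) nE w6 w5N.
rewrite (main_termE (erefl N) nE w0 wE L0) b_evenE.
move: key; set T := 8 * pi ^+ 2 * _ * _; set I := \int[_]_x _ => key.
have T0 : 0 < T.
  apply: mulr_gt0; last by rewrite sqrtr_gt0 divr_gt0// mulr_gt0.
  by apply: mulr_gt0; [rewrite mulr_gt0 ?exprn_gt0|exact: saddle_height_gt0].
clearbody T I; set K := 13 + 3 * theta 2 pi^-1 in key *.
have K0 : 0 <= K by rewrite /K addr_ge0// mulr_ge0.
pose r := I / T.
have rK : `|r - 1| <= K / w.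
  have -> : r - 1 = (I - T) / T by rewrite /r; field; rewrite gt_eqF.
  by rewrite normrM normfV (gtr0_norm T0) ler_pdivrMr// mulrC.
pose s := (ln w + ln pi) / w.
have s0 : 0 <= s by rewrite /s divr_ge0 ?(ltW w0)//; lra.
pose q := (1 + s) `^ (7 / 4).
have qE : ((w / ln (2 * n%:R)) `^ (7 / 4))^-1 = q.
  by rewrite powRV ?divr_gt0// invf_div Lw.
have /andP[q1 q3] : 1 <= q <= 1 + 3 * s by exact: powR74_bounds.
have q4 : q <= 4 by apply: (le_trans q3); move: s1; rewrite -/s; clear; lra.
have f0 : (2 ^+ (2 * n) * (2 * n)`!%:R)^-1 != 0 :> R.
  by rewrite invr_neq0// mulf_neq0 ?expf_neq0 ?pnatr_eq0// -lt0n fact_gt0.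
have -> : (2 ^+ (2 * n) * (2 * n)`!%:R)^-1 * I /
    ((2 ^+ (2 * n) * (2 * n)`!%:R)^-1 * T * (w / ln (2 * n%:R)) `^ (7 / 4)) = r * q.
  have : (w / ln (2 * n%:R)) `^ (7 / 4) != 0.
    by apply/lt0r_neq0/powR_gt0; exact: divr_gt0.
  rewrite -qE /r; move: ((2 ^+ (2 * n) * (2 * n)`!%:R)^-1) f0 => f f0.
  move: ((w / ln (2 * n%:R)) `^ (7 / 4)) => p p0.
  by field; rewrite f0 p0 gt_eqF.
have : `|r * q - 1| <= (4 * K + 15) * (ln w / w).
  have -> : r * q - 1 = (r - 1) * q + (q - 1) by ring.
  apply: (le_trans (ler_normD _ _)).
  rewrite normrM (ger0_norm (le_trans ler01 q1)) (ger0_norm (_ : 0 <= q - 1)) ?subr_ge0//.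
  apply: (@le_trans _ _ (K / w * 4 + 3 * s)).
    apply: lerD; last by rewrite lerBlDl.
    by rewrite ler_pM// (le_trans ler01).
  rewrite (_ : _ + _ = (4 * K + 3 * ln w + 3 * ln pi) / w); last first.
    by rewrite /s; field; rewrite gt_eqF.
  rewrite [leRHS]mulrA ler_wpM2r ?invr_ge0 ?(ltW w0)//.
  have : K * 1 <= K * ln w by rewrite ler_wpM2l.
  by lra.
move=> /le_trans; apply.
rewrite -[leRHS]mulrA [leRHS]mulrCA ler_wpM2l//; first by rewrite addr_ge0// mulr_ge0.
have ln0 : 0 < ln n%:R :> R by exact: lt_le_trans wn.
have lle : ln w <= ln (ln n%:R) by rewrite ler_ln ?posrE.
rewrite ler_pdivrMr// (_ : 2 * _ * w = ln (ln n%:R) * (2 * w) / ln n%:R); last by ring.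
by rewrite ler_pdivlMr// ler_pM// ?(ltW ln0)// (le_trans ler01).
Qed.

End main_term.

Theorem theorem2p7 (R : realType) :
  exists2 eps : nat -> R,
    eps =O_\oo (fun n : nat => ln (ln n%:R) / ln n%:R : R) &
    \forall n \near \oo,
      b_even R n =
      (1 + eps n)
      * (pi `^ (1 / 4) / (2 `^ (4 * n%:R - 5 / 2) * (2 * n)`!%:R))
      * ((2 * n%:R) / ln (2 * n%:R)) `^ (7 / 4)
      * expR (2 * n%:R * (ln (2 * n%:R / pi)
                          - lambertW (2 * n%:R / pi)
                          - (lambertW (2 * n%:R / pi))^-1)
              - 1 / 16 * lambertW (2 * n%:R / pi) ^+ 2).
Proof.
exists (fun n => b_even R n / main_term n - 1).
  have C0 : 0 <= theta 2 pi^-1 :> R by apply: theta_ge0; rewrite invr_gt0 pi_gt0.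
  have W720 : \forall n \near \oo, 720 <= lambertW (2 * n%:R / pi : R).
    by apply: filterS (lambertW_near_infty (ler0n R 720)) => n /ltW.
  apply/eqO_exP; exists (2 * (4 * (13 + 3 * theta 2 pi^-1) + 15)); first by lra.
  near=> n.
  have n0 : (0 < n)%N by near: n; exact: nbhs_infty_gt.
  have w720 : 720 <= lambertW (2 * n%:R / pi) :> R.
    by near: n; exact: W720.
  apply: (le_trans (relative_error n0 erefl w720)).
  by rewrite ler_wpM2l ?ler_norm//; lra.
near=> n.
have n2 : (1 < n)%N by near: n; exact: nbhs_infty_gt.
have m0 : 0 < main_term n :> R.
  apply: main_term_gt0; first exact: ltnW.
  by apply: ln_gt0; rewrite -natrM ltr1n; lia.
rewrite [1 + _]addrC subrK.
have assoc (q a b c : R) : q * (a * b * c) = q * a * b * c by rewrite !mulrA.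
apply: etrans (assoc _ _ _ _); rewrite -/(main_term n).
by rewrite divfK// gt_eqF.
Unshelve. all: by end_near. Qed.
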